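(* Let $\mathcal{H}$ be a complex Hilbert space, let $T_1,T_2\in\mathcal{B}(\mathcal{H})$ be contractions and let $Q\in\mathcal{B}(\mathcal{H})$ be a unitary such that $T_2T_1=QT_1T_2$ (respectively $T_2T_1=T_1T_2Q$). Then there exist a Hilbert space $\mathcal{K}\supseteq\mathcal{H}$ and unitaries $\overline{Q},U_1,U_2\in\mathcal{B}(\mathcal{K})$, where $\mathcal{H}$ reduces $\overline{Q}$ and $\overline{Q}|_{\mathcal{H}}=Q$, such that (i) $U_2U_1=\overline{Q}U_1U_2$ (respectively $U_2U_1=U_1U_2\overline{Q}$); and (ii) $T_1^nT_2^m=P_{\mathcal{H}}U_1^nU_2^m|_{\mathcal{H}}$ and $T_2^nT_1^m=P_{\mathcal{H}}U_2^nU_1^m|_{\mathcal{H}}$ for all integers $n,m\geq 0$. In fact, given any $q\in\mathbb{T}=\{z\in\mathbb{C}:|z|=1\}$, one can choose $\overline{Q}=Q\oplus qI_{\mathcal{K}\ominus\mathcal{H}}$.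
   Context: $\mathcal{B}(\cdot)$ denotes bounded linear operators; $P_{\mathcal{H}}\in\mathcal{B}(\mathcal{K})$ is the orthogonal projection of $\mathcal{K}$ onto the closed subspace $\mathcal{H}$. *)

(* Defs.v *)
From mathcomp Require Import all_boot all_order all_algebra.
From mathcomp Require Import complex.
From mathcomp Require Import reals Rstruct.
Set Implicit Arguments. Unset Strict Implicit. Unset Printing Implicit Defensive.
Import Order.TTheory GRing.Theory Num.Theory.
Local Open Scope ring_scope.

Definition C : numClosedFieldType := (Rdefinitions.R)[i].

Record hilbertSpace := HilbertSpace {
  hs_car :> lmodType C;
  hs_inner : hs_car -> hs_car -> C;
  hs_innerDZl : forall (a : C) (x y z : hs_car),
      hs_inner (a *: x + y) z = a * hs_inner x z + hs_inner y z;
  hs_innerC : forall x y : hs_car, hs_inner y x = (hs_inner x y)^*;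
  hs_inner_ge0 : forall x : hs_car, 0 <= hs_inner x x;
  hs_inner_eq0 : forall x : hs_car, hs_inner x x = 0 -> x = 0;
  hs_complete : forall u : nat -> hs_car,
      (forall e : C, 0 < e -> exists N : nat, forall m n : nat,
          (N <= m)%N -> (N <= n)%N ->
          sqrtC (hs_inner (u m - u n) (u m - u n)) < e) ->
      exists l : hs_car, forall e : C, 0 < e -> exists N : nat, forall n : nat,
          (N <= n)%N -> sqrtC (hs_inner (u n - l) (u n - l)) < e
}.

Definition inner (H : hilbertSpace) : H -> H -> C := @hs_inner H.
Definition hnorm (H : hilbertSpace) (x : H) : C := sqrtC (inner x x).

Definition is_linear (H K : hilbertSpace) (T : H -> K) : Prop :=
  forall (a : C) (x y : H), T (a *: x + y) = a *: T x + T y.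

Definition bounded_op (H : hilbertSpace) (T : H -> H) : Prop :=
  is_linear T /\ exists M : C, forall x : H, hnorm (T x) <= M * hnorm x.

Definition is_adjoint (H K : hilbertSpace) (T : H -> K) (S : K -> H) : Prop :=
  forall (x : H) (y : K), inner (T x) y = inner x (S y).

Definition contraction (H : hilbertSpace) (T : H -> H) : Prop :=
  bounded_op T /\ forall x : H, hnorm (T x) <= hnorm x.

Definition unitary (H : hilbertSpace) (U : H -> H) : Prop :=
  bounded_op U /\ exists S : H -> H,
    is_adjoint U S /\ (forall x, S (U x) = x) /\ (forall x, U (S x) = x).

(* J : H -> K realises H as a (closed) subspace of K: J is a linear
   isometric embedding (it preserves the inner product). *)
Definition isometric_embedding (H K : hilbertSpace) (J : H -> K) : Prop :=
  is_linear J /\ forall x y : H, inner (J x) (J y) = inner x y.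

Definition orth_to_range (H K : hilbertSpace) (J : H -> K) (k : K) : Prop :=
  forall h : H, inner k (J h) = 0.

Definition orth_proj_onto (H K : hilbertSpace) (J : H -> K) (P : K -> K) : Prop :=
  forall k : K, (exists h : H, P k = J h) /\ orth_to_range J (k - P k).

Definition reduces (H K : hilbertSpace) (J : H -> K) (A : K -> K) : Prop :=
  (forall h : H, exists h' : H, A (J h) = J h') /\
  (forall k : K, orth_to_range J k -> orth_to_range J (A k)).

Definition opow (H : hilbertSpace) (T : H -> H) (n : nat) : H -> H := iter n T.

(* Main.v *)
Require Import Defs.
From HB Require Import structures.
From mathcomp Require Import all_boot all_order all_algebra.
From mathcomp Require Import complex.
From mathcomp Require Import boolp classical_sets functions.
From mathcomp Require Import reals Rstruct topology normedtype sequences.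
From mathcomp Require Import ring lra.
(* [sequences] also defines a [contraction]. *)
Import Defs.
Set Implicit Arguments. Unset Strict Implicit. Unset Printing Implicit Defensive.
Import Order.TTheory GRing.Theory Num.Theory.
Import numFieldNormedType.Exports.
Local Open Scope ring_scope.

(* Each contraction [T] has a defect operator [D], [D^2 = 1 - T^* T], and [h |-> (T h, D h)]
   extends to a unitary [J] of [H + E] with [E = H + H] (the second copy of [H] is padding).
   Let [K = H + l2(E)^2 + l2(E)^2], with an incoming and an outgoing half made of two
   channels each, and let [W_i] apply the unitary [J_i] to [H] and the last incoming
   coordinate of channel [i], and shift channel [i].  Both [W_2 W_1] and [W_1 W_2] then
   shift both channels by one step; on [H + E^2] they act by unitaries [A] and [B] with
   [A h = (T2 T1 h, alpha h)] and [B h = (T1 T2 h, beta h)].  As in Ando's theorem,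
   [T2 T1 = Q T1 T2] gives [|alpha h| = |beta h|], so the padding yields a unitary [g] of
   [E^2] with [q g beta = alpha]; it is made out of one reflection.  Then
   [A^-1 (Q + q g) B] fixes [H], hence is [1 + g_-].  Letting [G] act as [q^-n g] on the
   outgoing and as [q^n g_-] on the incoming coordinates one gets
   [W_2 W_1 G = (Q + q) G W_1 W_2], and [U_1 = G W_1], [U_2 = W_2 G^-1] are the required
   unitaries: they map [H + outgoing] to itself, and their compressions to [H] are [T_i].
   The other relation is treated in the same way with [U_1 = W_1 G], [U_2 = G^-1 W_2]. *)

Local Notation R := Rdefinitions.R.

(** * Inner products *)

Definition cR (r : R) : C := (r%:C)%C.
Definition ReC (z : C) : R := complex.Re z.
Definition ImC (z : C) : R := complex.Im z.
Definition iC : C := ('i)%C.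

Lemma ReImC_eq (z w : C) : ReC z = ReC w -> ImC z = ImC w -> z = w.
Proof. by case: z w => [a b] [c d] /= -> ->. Qed.

Lemma ReCD z w : ReC (z + w) = ReC z + ReC w. Proof. by case: z w => [a b] [c d]. Qed.
Lemma ImCD z w : ImC (z + w) = ImC z + ImC w. Proof. by case: z w => [a b] [c d]. Qed.
Lemma ReCN z : ReC (- z) = - ReC z. Proof. by case: z. Qed.
Lemma ReCM z w : ReC (z * w) = ReC z * ReC w - ImC z * ImC w.
Proof. by case: z w => [a b] [c d]. Qed.
Lemma ImCM z w : ImC (z * w) = ReC z * ImC w + ImC z * ReC w.
Proof. by case: z w => [a b] [c d]. Qed.
Lemma ReC_conj (z : C) : ReC z^* = ReC z. Proof. by case: z. Qed.
Lemma ImC_conj (z : C) : ImC z^* = - ImC z. Proof. by case: z. Qed.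
Lemma ReC_sum n (F : nat -> C) : ReC (\sum_(i < n) F i) = \sum_(i < n) ReC (F i).
Proof. by elim: n => [|n IH]; rewrite ?big_ord0 // !big_ord_recr /= ReCD IH. Qed.
Lemma ImC_sum n (F : nat -> C) : ImC (\sum_(i < n) F i) = \sum_(i < n) ImC (F i).
Proof. by elim: n => [|n IH]; rewrite ?big_ord0 // !big_ord_recr /= ImCD IH. Qed.

Lemma ge0_cR (z : C) : 0 <= z -> z = cR (ReC z).
Proof. by case: z => a b; rewrite lecE /= => /andP[/eqP -> _]. Qed.

Lemma le_cR (a b : R) : (cR a <= cR b) = (a <= b).
Proof. exact: lecR. Qed.

Lemma lt_cR (a b : R) : (cR a < cR b) = (a < b).
Proof. exact: ltcR. Qed.

(** Passage from the norm conditions in [hilbertSpace] to inequalities between real squared norms,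
    within reach of [lra] and [nra]. *)
Lemma sqrtC_lt_cR (z : C) (r : R) : 0 <= z -> 0 < r -> (sqrtC z < cR r) = (ReC z < r ^+ 2).
Proof.
move=> z0 r0; have r0' : 0 <= cR r by rewrite (le_cR 0) ltW.
rewrite -{1}(sqrCK r0') ltr_sqrtC ?nnegrE ?exprn_ge0 //.
by rewrite {1}(ge0_cR z0) -lt_cR -[cR r ^+ 2]/(cR r * cR r) expr2 /cR rmorphM.
Qed.

Lemma mul_conj_unit (q : C) : `|q| = 1 -> q * q^* = 1.
Proof. by rewrite -normCK => ->; rewrite expr1n. Qed.

Lemma inv_nat_small (e : R) : 0 < e -> exists N, forall n, (N <= n)%N -> n.+1%:R^-1 < e.
Proof.
move=> e0; exists (Num.bound e^-1) => n Nn.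
rewrite invf_plt ?posrE //; apply: (lt_le_trans (archi_boundP _)); first by rewrite invr_ge0 ltW.
by rewrite ler_nat; exact: leqW.
Qed.

Section InnerProduct.
Variable H : hilbertSpace.
Implicit Types x y z : H.

Lemma innerDl x y z : inner (x + y) z = inner x z + inner y z.
Proof. by rewrite -[x]scale1r [LHS]hs_innerDZl mul1r scale1r. Qed.

Lemma inner0l z : inner 0 z = 0.
Proof. by apply: (addrI (inner 0 z)); rewrite -innerDl !addr0. Qed.

Lemma innerZl a x z : inner (a *: x) z = a * inner x z.
Proof.
by have := @hs_innerDZl H a x 0 z; rewrite addr0 -!/(@inner H _ _) inner0l addr0.
Qed.

Lemma innerJ x y : inner y x = (inner x y)^*. Proof. exact: hs_innerC. Qed.

Lemma innerDr x y z : inner z (x + y) = inner z x + inner z y.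
Proof. by rewrite innerJ innerDl rmorphD /= -!innerJ. Qed.

Lemma innerZr a x z : inner z (a *: x) = a^* * inner z x.
Proof. by rewrite innerJ innerZl rmorphM /= -!innerJ. Qed.

Lemma inner0r z : inner z 0 = 0.
Proof. by rewrite innerJ inner0l rmorph0. Qed.

Lemma innerNl x z : inner (- x) z = - inner x z.
Proof. by rewrite -scaleN1r innerZl mulN1r. Qed.

Lemma innerNr x z : inner z (- x) = - inner z x.
Proof. by rewrite innerJ innerNl rmorphN /= -innerJ. Qed.

(** The underlying real inner product: estimates are made over the reals, and [innerE] recovers the
    complex inner product. *)
Definition rin x y : R := ReC (inner x y).
Definition nsq x : R := rin x x.

Lemma inner_nsq x : inner x x = cR (nsq x).
Proof. exact/ge0_cR/hs_inner_ge0. Qed.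

Lemma nsq_ge0 x : 0 <= nsq x.
Proof. by rewrite -le_cR -inner_nsq; exact: hs_inner_ge0. Qed.

Lemma nsq_eq0 x : nsq x = 0 -> x = 0.
Proof. by move=> x0; apply: hs_inner_eq0; rewrite [LHS]inner_nsq x0. Qed.

(** Conjugate-linearity in the second argument turns the real part of the product with [iC *: y]
    into the imaginary part. *)
Lemma innerE x y : inner x y = (rin x y +i* rin x (iC *: y))%C.
Proof.
by apply: ReImC_eq => //=; rewrite /rin innerZr ReCM /=; case: (inner x y) => a b /=; ring.
Qed.

Lemma rinC x y : rin x y = rin y x.
Proof. by rewrite /rin innerJ ReC_conj. Qed.
Lemma rinDl x y z : rin (x + y) z = rin x z + rin y z.
Proof. by rewrite /rin innerDl ReCD. Qed.
Lemma rinDr x y z : rin z (x + y) = rin z x + rin z y.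
Proof. by rewrite /rin innerDr ReCD. Qed.
Lemma rinZl r x z : rin (cR r *: x) z = r * rin x z.
Proof. by rewrite /rin innerZl ReCM /= mul0r subr0. Qed.
Lemma rinZr r x z : rin z (cR r *: x) = r * rin z x.
Proof. by rewrite rinC rinZl rinC. Qed.
Lemma rinNl x z : rin (- x) z = - rin x z.
Proof. by rewrite /rin innerNl ReCN. Qed.
Lemma rinNr x z : rin z (- x) = - rin z x.
Proof. by rewrite rinC rinNl rinC. Qed.
Lemma rin0l z : rin 0 z = 0. Proof. by rewrite /rin inner0l. Qed.
Lemma rin0r z : rin z 0 = 0. Proof. by rewrite /rin inner0r. Qed.

Definition rinE := (rinDl, rinDr, rinZl, rinZr, rinNl, rinNr).

Lemma nsqN x : nsq (- x) = nsq x.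
Proof. by rewrite /nsq !rinE opprK. Qed.
Lemma nsq_subC x y : nsq (x - y) = nsq (y - x).
Proof. by rewrite -nsqN opprB. Qed.
Lemma nsqD x y : nsq (x + y) = nsq x + 2 * rin x y + nsq y.
Proof. by rewrite /nsq !rinE (rinC y x); ring. Qed.

Lemma cauchy_schwarz x y : rin x y ^+ 2 <= nsq x * nsq y.
Proof.
have [y0|yn0] := eqVneq (nsq y) 0; first by rewrite (nsq_eq0 y0) rin0r /nsq rin0r; nra.
have yp : 0 < nsq y by rewrite lt_def yn0 nsq_ge0.
(* The residual of [x] after real projection onto the line of [y]; non-negativity of its squared
   norm is the claim divided by [nsq y]. *)
have := nsq_ge0 (x + cR (- (rin x y / nsq y)) *: y).
rewrite nsqD /nsq !rinE -/(nsq x) -/(nsq y).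
set c := rin x y / nsq y.
have -> : rin x y = c * nsq y by rewrite /c divfK.
nra.
Qed.

Lemma nsqD_le x y : nsq (x + y) <= 2 * nsq x + 2 * nsq y.
Proof.
have := nsq_ge0 (x - y); rewrite !nsqD nsqN rinNr; lra.
Qed.

Lemma nsqZ (a : C) x : nsq (a *: x) = (ReC a ^+ 2 + ImC a ^+ 2) * nsq x.
Proof.
rewrite /nsq /rin innerZl innerZr inner_nsq !ReCM !ImCM /= ReC_conj ImC_conj; ring.
Qed.

Lemma hnorm_lt x (e : R) : 0 < e -> (hnorm x < cR e) = (nsq x < e ^+ 2).
Proof. by move=> e0; rewrite /hnorm sqrtC_lt_cR //; exact: hs_inner_ge0. Qed.

Lemma nsq_complete (u : nat -> H) :
  (forall e : R, 0 < e -> exists N, forall m n, (N <= m)%N -> (N <= n)%N ->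
     nsq (u m - u n) < e) ->
  exists l, forall e : R, 0 < e -> exists N, forall n, (N <= n)%N -> nsq (u n - l) < e.
Proof.
move=> cu; have [|l lP] := @hs_complete H u.
  move=> e e0; move: (e0); rewrite (ge0_cR (ltW e0)) (lt_cR 0) => r0.
  have [N NP] := cu (ReC e ^+ 2) (exprn_gt0 _ r0).
  by exists N => m n Nm Nn; have := NP _ _ Nm Nn; rewrite -hnorm_lt.
exists l => e e0; have se0 : 0 < Num.sqrt e by rewrite sqrtr_gt0.
have [|N NP] := lP (cR (Num.sqrt e)); first by rewrite (lt_cR 0).
exists N => n Nn; rewrite -(sqr_sqrtr (ltW e0)) -hnorm_lt //; exact: NP.
Qed.

Lemma ext_inner x y : (forall z, inner z x = inner z y) -> x = y.
Proof.
move=> xy; apply/subr0_eq/hs_inner_eq0.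
by rewrite [LHS]innerDr innerNr xy subrr.
Qed.

End InnerProduct.

Lemma hnorm_le (H K : hilbertSpace) (x : H) (y : K) : (hnorm x <= hnorm y) = (nsq x <= nsq y).
Proof.
by rewrite /hnorm !inner_nsq ler_sqrtC ?le_cR // nnegrE (le_cR 0) nsq_ge0.
Qed.

(** * Riesz representation and projections *)

(** Used to identify limits: Cauchy-Schwarz controls the square of a difference, not the difference
    itself. *)
Lemma sqr_small_eq0 (d K : R) : (forall e : R, 0 < e -> d ^+ 2 <= K * e) -> d = 0.
Proof.
move=> dK; apply/eqP; rewrite -sqrf_eq0; apply/eqP.
have K0 : 0 <= K by have := dK 1 ltr01; have := sqr_ge0 d; lra.
apply: le_anti; rewrite sqr_ge0 andbT; apply/ler_addgt0Pl => e e0; rewrite addr0.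
have K1 : 0 < K + 1 by lra.
apply: (le_trans (dK (e / (K + 1)) (divr_gt0 e0 K1))).
rewrite mulrA ler_pdivrMr //; nra.
Qed.

(** * Norm convergence of sequences *)

Definition cvgH (H : hilbertSpace) (u : nat -> H) (l : H) :=
  forall e : R, 0 < e -> exists N, forall n, (N <= n)%N -> nsq (u n - l) < e.

Section Convergence.
Variable H : hilbertSpace.
Implicit Types (u v : nat -> H) (l m z w : H).

Lemma cvgH_near2 u v l m (e : R) : cvgH u l -> cvgH v m -> 0 < e ->
  exists N, forall n, (N <= n)%N -> nsq (u n - l) < e /\ nsq (v n - m) < e.
Proof.
move=> ul vm e0; have [N1 h1] := ul e e0; have [N2 h2] := vm e e0.
by exists (maxn N1 N2) => n; rewrite geq_max => /andP[a b]; split; [apply: h1|apply: h2].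
Qed.

(** For every n the discrepancy of the limits is [rin (v n - m) w - rin (u n - l) z], and
    Cauchy-Schwarz makes both terms small. *)
Lemma cvgH_rin_eq u v l m z w : cvgH u l -> cvgH v m ->
  (forall n, rin (u n) z = rin (v n) w) -> rin l z = rin m w.
Proof.
move=> ul vm uv; apply/subr0_eq/(@sqr_small_eq0 _ (2 * (nsq z + nsq w))) => e e0.
have [N /(_ N (leqnn N)) [h1 h2]] := cvgH_near2 ul vm e0.
have -> : rin l z - rin m w = rin (v N - m) w - rin (u N - l) z.
  by rewrite !rinE uv; ring.
have := cauchy_schwarz (v N - m) w; have := cauchy_schwarz (u N - l) z.
have := nsq_ge0 z; have := nsq_ge0 w; set a := rin _ _; set b := rin _ _ => w0 z0 ha hb.
have := sqr_ge0 (a + b).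
suff : nsq (u N - l) * nsq z <= nsq z * e /\ nsq (v N - m) * nsq w <= nsq w * e by nra.
by split; rewrite mulrC ler_wpM2l // ltW.
Qed.

Lemma cvgH_unique u l m : cvgH u l -> cvgH u m -> l = m.
Proof.
move=> ul um; apply/subr0_eq/nsq_eq0.
rewrite /nsq rinDl rinNl; apply/eqP; rewrite subr_eq0; apply/eqP.
exact: (cvgH_rin_eq ul um).
Qed.

Lemma cvgHD u v l m : cvgH u l -> cvgH v m -> cvgH (fun n => u n + v n) (l + m).
Proof.
move=> ul vm e e0; have [|N NP] := cvgH_near2 ul vm (e := e / 4); first by lra.
exists N => n /NP[h1 h2].
have -> : u n + v n - (l + m) = (u n - l) + (v n - m) by rewrite opprD addrACA.
apply: (le_lt_trans (nsqD_le _ _)); lra.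
Qed.

Lemma cvgHZ (a : C) u l : cvgH u l -> cvgH (fun n => a *: u n) (a *: l).
Proof.
move=> ul e e0; set c := ReC a ^+ 2 + ImC a ^+ 2.
have c0 : 0 <= c by rewrite addr_ge0 ?sqr_ge0.
have c1 : 0 < c + 1 by lra.
have [N NP] := ul (e / (c + 1)) (divr_gt0 e0 c1).
exists N => n /NP; rewrite ltr_pdivlMr // -scalerBr nsqZ -/c.
by have := nsq_ge0 (u n - l); nra.
Qed.

Lemma cvgH_cst l : cvgH (fun=> l) l.
Proof. by move=> e e0; exists 0%N => n _; rewrite subrr /nsq rin0r. Qed.

Lemma cvgHS u l : cvgH u l -> cvgH (fun n => u n.+1) l.
Proof. by move=> ul e /ul[N NP]; exists N => n Nn; apply: NP; exact: leqW. Qed.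

End Convergence.

(* Minimising [nsq x - 2 Re (phi x)] over [M] gives both the Riesz representation
   theorem ([M] the whole space) and orthogonal projections ([phi] an inner product). *)
Lemma riesz_submodule (H : hilbertSpace) (M : H -> Prop) (phi : H -> C) (c : R) :
  M 0 -> (forall a x y, M x -> M y -> M (a *: x + y)) ->
  (forall a x y, phi (a *: x + y) = a * phi x + phi y) ->
  0 <= c -> (forall x, ReC (phi x) ^+ 2 <= c * nsq x) ->
  exists y, (forall x, M x -> phi x = inner x y) /\
    (forall z, (forall x, M x -> inner x z = 0) -> inner y z = 0).
Proof.
move=> M0 Mlin plin c0 pbound.
have phi0 : phi 0 = 0.
  have := plin 1 0 0; rewrite scaler0 addr0 mul1r => /eqP.
  by rewrite -{1}[phi 0]addr0 (inj_eq (addrI _)) => /eqP <-.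
pose psi x := ReC (phi x).
have psiD x y : psi (x + y) = psi x + psi y.
  by rewrite /psi -[x]scale1r plin mul1r ReCD scale1r.
have psiZ r x : psi (cR r *: x) = r * psi x.
  by rewrite /psi -[_ *: _]addr0 plin phi0 addr0 ReCM /= mul0r subr0.
pose E x := nsq x - 2 * psi x.
(* From p^2 <= c n the arithmetic-geometric inequality gives 2 p <= n + c, so [E] is bounded below;
   its infimum [mu] is taken as minus a supremum. *)
have E_ge x : - c <= E x.
  have := pbound x; rewrite -/(psi x) /E; have := nsq_ge0 x.
  move: (nsq x) (psi x) => n p n0 h.
  suff : 2 * p <= n + c by lra.
  rewrite real_leNgt ?num_real //; apply/negP => hlt.
  have : (n + c) ^+ 2 < (2 * p) ^+ 2 by rewrite ltrXn2r //; lra.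
  have := sqr_ge0 (n - c); nra.
pose S := [set r | exists2 x, M x & r = - E x]%classic.
have Ssup : has_sup S.
  split; first by exists (- E 0), 0.
  by exists c => _ [x _ ->]; have := E_ge x; lra.
pose mu := - sup S.
have mu_le x : M x -> mu <= E x.
  move=> Mx; rewrite /mu; suff : - E x <= sup S by lra.
  by apply: sup_upper_bound => //; exists x.
have /boolp.choice[u uP] (n : nat) : exists x, M x /\ E x < mu + n.+1%:R^-1.
  have n0 : 0 < n.+1%:R^-1 :> R by rewrite invr_gt0.
  have [_ [x Mx ->] h] := sup_adherent n0 Ssup; exists x; split => //.
  by rewrite /mu -ltrN2 opprD opprK.
(* The linear terms cancel; as the midpoint has energy at least [mu], a minimising sequence is
   Cauchy. *)
have parallelogram x y : nsq (x - y) = 2 * E x + 2 * E y - 4 * E (cR (1 / 2) *: (x + y)).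
  by rewrite /E psiZ psiD /nsq !rinE (rinC y x); field.
have [y uy] : exists y, cvgH u y.
  apply: nsq_complete => e e0.
  have [|N NP] := @inv_nat_small (e / 4); first by lra.
  exists N => m n /NP hm /NP hn; rewrite parallelogram.
  have Mh : M (cR (1 / 2) *: (u m + u n)).
    rewrite -[_ *: _]addr0; apply: (Mlin) => //; rewrite -[u m]scale1r.
    by apply: Mlin; [exact: (uP m).1|exact: (uP n).1].
  move: (mu_le _ Mh) (uP m).2 (uP n).2 hm hn.
  move: (m.+1%:R^-1) (n.+1%:R^-1) => dm dn; lra.
have psiE h : M h -> psi h = rin h y.
  move=> Mh; apply/eqP; rewrite eq_sym -subr_eq0; apply/eqP.
  apply: (@sqr_small_eq0 _ (2 * (2 * nsq h + 1))) => e e0.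
  have [N1 NP1] := uy e e0; have [N2 NP2] := inv_nat_small e0.
  pose n := maxn N1 N2.
  have {NP1} h1 := NP1 n (leq_maxl _ _); have {NP2} h2 := NP2 n (leq_maxr _ _).
  (* [w] is the defect of the Euler equation at the approximate minimiser [u n]. Comparing [E] at
     [u n] and at [cR t *: h + u n] gives [key]; [t] nearly minimises its right side, and the
     summand 1 keeps the denominator positive. *)
  pose w := rin h (u n) - psi h.
  have wP : w ^+ 2 <= (nsq h + 1) * e.
    have N0 := nsq_ge0 h; pose t := - (w / (nsq h + 1)).
    have Mt : M (cR t *: h + u n) by apply: Mlin => //; exact: (uP n).1.
    have key : 0 <= t ^+ 2 * nsq h + 2 * t * w + e.
      have := mu_le _ Mt; move: (uP n).2 h2; move: (n.+1%:R^-1) => d.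
      rewrite /E psiD psiZ nsqD {2}/nsq !rinE -/(nsq h).
      have -> : rin h (u n) = w + psi h by rewrite /w; ring.
      lra.
    have wt : w = - t * (nsq h + 1) by rewrite /t opprK divfK // lt0r_neq0 //; lra.
    clearbody t; clearbody w; subst w; move: (nsq h) N0 key => N N0 key.
    have : t ^+ 2 * (N + 2) <= e by lra.
    have := sqr_ge0 t; nra.
  have -> : rin h y - psi h = w - rin h (u n - y) by rewrite /w !rinE; ring.
  have := cauchy_schwarz h (u n - y); have := sqr_ge0 (w + rin h (u n - y)).
  have : nsq h * nsq (u n - y) <= nsq h * e by rewrite ler_wpM2l ?nsq_ge0 // ltW.
  nra.
have MZ a x : M x -> M (a *: x) by move=> Mx; rewrite -[_ *: _]addr0; apply: Mlin.
exists y; split=> [x Mx|z zM].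
  apply: ReImC_eq; first exact: psiE.
  have := psiE _ (MZ iC x Mx); rewrite /psi -[iC *: x]addr0 plin phi0 !addr0.
  by rewrite /rin innerZl !ReCM /= !mul0r !mul1r !sub0r => /oppr_inj.
(* That [y] lies in the closure of [M] is expressed as orthogonality to everything orthogonal to
   [M]; this holds for each [u n] and passes to the limit. *)
have key z' : (forall x, M x -> inner x z' = 0) -> rin y z' = 0.
  move=> zM'; rewrite -(rin0l z'); apply: (cvgH_rin_eq uy (cvgH_cst 0)) => n.
  by rewrite rin0l /rin zM' //; exact: (uP n).1.
rewrite innerE !key // => x Mx; rewrite innerZr zM // mulr0 //.
Qed.

(** * Linear maps and unitaries between Hilbert spaces *)

Section Linear.
Variables (H K : hilbertSpace) (T : H -> K).
Hypothesis Tlin : is_linear T.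

Lemma lin_D x y : T (x + y) = T x + T y.
Proof. by have := Tlin 1 x y; rewrite !scale1r. Qed.
Lemma lin_0 : T 0 = 0.
Proof. by apply: (addrI (T 0)); rewrite -lin_D !addr0. Qed.
Lemma lin_Z a x : T (a *: x) = a *: T x.
Proof. by have := Tlin a x 0; rewrite lin_0 !addr0. Qed.
Lemma lin_N x : T (- x) = - T x.
Proof. by rewrite -scaleN1r lin_Z scaleN1r. Qed.
Lemma lin_B x y : T (x - y) = T x - T y.
Proof. by rewrite lin_D lin_N. Qed.
End Linear.

(** Unitarity between possibly different spaces, with the inverse [V] as data because the final
    dilations contain an explicit inverse. *)
Record hilbert_iso (H K : hilbertSpace) (U : H -> K) (V : K -> H) : Prop := HilbertIso {
  iso_lin : is_linear U;
  iso_inner : forall x y, inner (U x) (U y) = inner x y;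
  isoK : cancel U V;
  isoKV : cancel V U }.

Lemma hilbert_iso_sym (H K : hilbertSpace) (U : H -> K) V : hilbert_iso U V -> hilbert_iso V U.
Proof.
case=> Ulin Uin UK VK; split=> //; last by move=> x y; rewrite -Uin !VK.
by move=> a x y; apply: (can_inj UK); rewrite Ulin !VK.
Qed.

Lemma hilbert_iso_comp (H K L : hilbertSpace) (U : H -> K) V (U' : K -> L) V' :
  hilbert_iso U V -> hilbert_iso U' V' -> hilbert_iso (U' \o U) (V \o V').
Proof.
case=> a b c d [a' b' c' d']; split=> [s x y|x y||] /=; first by rewrite a a'.
- by rewrite b' b.
- exact: can_comp.
- exact: can_comp.
Qed.

Lemma hilbert_iso_id (H : hilbertSpace) : hilbert_iso (@id H) id.
Proof. by []. Qed.

Lemma hilbert_iso_scale (H : hilbertSpace) (q : C) : `|q| = 1 ->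
  hilbert_iso (fun x : H => q *: x) (fun x => q^* *: x).
Proof.
move=> /mul_conj_unit qq; split=> [a x y|x y|x|x].
- by rewrite scalerDr !scalerA mulrC.
- by rewrite innerZl innerZr mulrA qq mul1r.
- by rewrite scalerA mulrC qq scale1r.
- by rewrite scalerA qq scale1r.
Qed.

Lemma hilbert_iso_unitary (H : hilbertSpace) (U V : H -> H) : hilbert_iso U V -> unitary U.
Proof.
case=> Ulin Uin UK VK; split; last by exists V; split=> // x y; rewrite -[y in LHS]VK Uin.
by split=> //; exists 1 => x; rewrite mul1r /hnorm Uin.
Qed.

Lemma unitary_hilbert_iso (H : hilbertSpace) (U : H -> H) :
  unitary U -> exists V, hilbert_iso U V.
Proof.
case=> [[Ulin _] [V [adj [UK VK]]]]; exists V; split=> // x y.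
by rewrite adj UK.
Qed.

(* [1 - 2P], with [P] the projection onto the closure of the range of [b - a],
   exchanges [a h] and [b h]. *)
Lemma exchange_reflection (L N : hilbertSpace) (a b : L -> N) :
  is_linear a -> is_linear b ->
  (forall h k, inner (a h) (a k) = inner (b h) (b k)) ->
  (forall h k, inner (a h) (b k) = 0) ->
  exists G, hilbert_iso G G /\ forall h, G (a h) = b h.
Proof.
move=> alin blin ab_eq ab0.
pose M z := exists h, z = b h - a h.
(* [spec x y] says that [y] is the projection of [x] onto the closure of [M]: [x - y] is orthogonal
   to [M], and [y] is orthogonal to the complement of [M]. *)
pose spec x y := (forall m, M m -> inner m x = inner m y) /\
  (forall z, (forall m, M m -> inner m z = 0) -> inner y z = 0).
have /boolp.choice[P PP] x : exists y, spec x y.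
  apply: (riesz_submodule (c := nsq x)).
  - by exists 0; rewrite (lin_0 alin) (lin_0 blin) subrr.
  - move=> s _ _ [h ->] [k ->]; exists (s *: h + k).
    by rewrite alin blin scalerBr opprD addrACA.
  - by move=> s y z; rewrite innerDl innerZl.
  - exact: nsq_ge0.
  - by move=> y; rewrite mulrC; exact: cauchy_schwarz.
(* The difference [y - P x] is orthogonal to [M], hence to both [y] and [P x], hence to itself. *)
have Puniq x y : spec x y -> y = P x.
  move=> [y1 y2]; have [p1 p2] := PP x.
  have orth m : M m -> inner m (y - P x) = 0.
    by move=> Mm; rewrite innerDr innerNr -y1 // -p1 // subrr.
  apply/subr0_eq/hs_inner_eq0; rewrite -/(inner _ _).
  by rewrite innerDl innerNl y2 // p2 // subrr.
have Plin : is_linear P.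
  move=> s x y; apply/esym/Puniq; have [x1 x2] := PP x; have [y1 y2] := PP y.
  split=> [m Mm|z zM]; first by rewrite !innerDr !innerZr x1 // y1.
  by rewrite innerDl innerZl x2 // y2 // mulr0 addr0.
have PK x : P (P x) = P x.
  by apply/esym/Puniq; split=> //; exact: (PP x).2.
have Pin x y : inner (P x) y = inner (P x) (P y).
  apply/subr0_eq; rewrite -innerNr -innerDr; apply: (PP x).2 => m Mm.
  by rewrite innerDr innerNr (PP y).1 // subrr.
have Pin' x y : inner x (P y) = inner (P x) (P y).
  by rewrite innerJ Pin -innerJ.
have GK : involutive (fun x => x - 2 *: P x).
  move=> x /=; rewrite (lin_B Plin) (lin_Z Plin) PK.
  have -> : P x - 2 *: P x = - P x by rewrite scaler_nat mulr2n opprD addrA subrr sub0r.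
  by rewrite scalerN opprK subrK.
exists (fun x => x - 2 *: P x); split; first split=> //.
- by move=> s x y; rewrite Plin !scalerDr !scalerA [2 * s]mulrC scalerN scalerA opprD addrACA.
- move=> x y; rewrite !innerDl !innerDr !innerNl !innerNr !innerZl !innerZr Pin Pin'.
  by rewrite conjC_nat; ring.
move=> h.
have ba0 k k' : inner (b k) (a k') = 0 by rewrite innerJ ab0 rmorph0.
(* The rest of [a h] is half of [a h + b h], orthogonal to every [b k - a k] because [a] and [b]
   have equal Gram forms and orthogonal ranges. Subtracting twice the projection from [a h]
   therefore leaves [b h]. *)
have <- : (2^-1 : C) *: (a h - b h) = P (a h).
  apply: Puniq; split=> [_ [k ->]|z zM].
    rewrite innerZr !innerDl !innerNl !innerDr !innerNr ab0 ba0 -ab_eq conj_Creal ?realV ?realn //.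
    by field.
  rewrite innerZl -opprB innerNl zM ?oppr0 ?mulr0 //; by exists h.
by rewrite scalerA mulfV ?pnatr_eq0 // scale1r opprB addrC subrK.
Qed.

(** * Defect operators *)

(** The triangle inequality for norms bounded by p and q times the root of N, stated without square
    roots. *)
Lemma nsqD_bound (H : hilbertSpace) (x y : H) (p q N : R) :
  0 <= p -> 0 <= q -> 0 <= N -> nsq x <= p ^+ 2 * N -> nsq y <= q ^+ 2 * N ->
  nsq (x + y) <= (p + q) ^+ 2 * N.
Proof.
move=> p0 q0 N0 xp yq; rewrite nsqD; have := cauchy_schwarz x y.
have h : nsq x * nsq y <= (p ^+ 2 * N) * (q ^+ 2 * N) by apply: ler_pM => //; exact: nsq_ge0.
move=> /le_trans /(_ h) {}h.
suff : rin x y <= p * q * N by nra.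
have pq : 0 <= p * q * N by rewrite !mulr_ge0.
rewrite real_leNgt ?num_real //; apply/negP => lt.
have : (p * q * N) ^+ 2 < rin x y ^+ 2 by rewrite ltrXn2r.
by rewrite ltNge; apply/negP; rewrite negbK; apply: (le_trans h); nra.
Qed.

(** [B] is T^* T, given by Riesz representation of the functional [inner (T x) (T y)] of [x]. Its
    contractivity is Cauchy-Schwarz applied to [nsq (B x) = rin (T (B x)) (T x)]. *)
Lemma bounded_form_operator (H : hilbertSpace) (T : H -> H) :
  is_linear T -> (forall x, nsq (T x) <= nsq x) ->
  exists B : H -> H, [/\ is_linear B, forall x, nsq (B x) <= nsq x
    & forall x y, inner x (B y) = inner (T x) (T y)].
Proof.
move=> Tlin Tc.
have /boolp.choice[B BP] y : exists z, forall x, inner (T x) (T y) = inner x z.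
  have [|||||z [zP _]] :=
    @riesz_submodule H (fun=> True) (fun x => inner (T x) (T y)) (nsq y) => //.
  - by move=> a x z; rewrite Tlin innerDl innerZl.
  - exact: nsq_ge0.
  - move=> x; apply: (le_trans (cauchy_schwarz _ _)); rewrite mulrC.
    by apply: ler_pM => //; exact: nsq_ge0.
  by exists z => x; exact: zP.
exists B; split=> // [a x y|x].
  by apply: ext_inner => z; rewrite innerDr innerZr -!BP Tlin innerDr innerZr.
have := cauchy_schwarz (T (B x)) (T x); rewrite {1}/rin BP -/(rin _ _) -/(nsq _).
have := Tc (B x); have := Tc x; have := nsq_ge0 (B x); have := nsq_ge0 (T x).
move: (nsq (B x)) (nsq (T (B x))) (nsq (T x)) (nsq x) => b tb t n t0 b0 h1 h2 h3.
have [->|bn0] := eqVneq b 0; first lra.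
have bp : 0 < b by rewrite lt_def bn0.
suff : b * b <= b * n by rewrite ler_pM2l.
by rewrite -expr2; apply: (le_trans h3); apply: ler_pM => //; nra.
Qed.

(* With [Y = (B + Y^2) / 2] one has [(1 - Y)^2 = 1 - B]. *)
Fixpoint sqrt_iter (H : hilbertSpace) (B : H -> H) (n : nat) (x : H) : H :=
  if n is m.+1 then cR (1 / 2) *: (B x + sqrt_iter B m (sqrt_iter B m x)) else 0.

(** The scalar iteration for B = 1. It increases to 1, and its increments dominate those of
    [sqrt_iter], which makes the operator iteration Cauchy. *)
Fixpoint sqrt_majorant (n : nat) : R :=
  if n is m.+1 then (1 + sqrt_majorant m ^+ 2) / 2 else 0.

Lemma sqrt_majorant_itv n : 0 <= sqrt_majorant n <= 1.
Proof. by elim: n => [|n /andP[h0 h1]] /=; apply/andP; split; nra. Qed.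

Lemma sqrt_majorant_le n : sqrt_majorant n <= sqrt_majorant n.+1.
Proof. by have := sqr_ge0 (1 - sqrt_majorant n); rewrite /=; lra. Qed.

(** An explicit rate of convergence to 1. With s = 2 / (n + 2), one step turns the bound 1 - s into
    1 - s + s^2 / 2, and the comparison with the next bound reduces to 4 - s^2 <= 4. *)
Lemma sqrt_majorant_ge n : 1 - 2 / n.+2%:R <= sqrt_majorant n.
Proof.
elim: n => [|n IH] /=; first by rewrite divff ?pnatr_eq0 // subrr.
have /andP[y0 y1] := sqrt_majorant_itv n.
rewrite -[n.+3%:R]natr1 -[n.+2%:R]natr1 in IH *.
have k1 : 1 <= n.+1%:R :> R by rewrite ler1n.
move: (sqrt_majorant n) (n.+1%:R : R) y0 y1 k1 IH => y k y0 y1 k1 IH.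
pose s := 2 / (k + 1).
have s1 : s * (k + 1) = 2 by rewrite /s divfK // lt0r_neq0 //; lra.
have s0 : 0 < s by rewrite divr_gt0 //; lra.
have sl : s <= 1 by nra.
have IH' : 1 - s <= y by [].
have : (1 - s) ^+ 2 <= y ^+ 2 by nra.
suff : 2 * (s - s ^+ 2 / 2) <= 2 * (2 / (k + 1 + 1)) by lra.
rewrite mulrA ler_pdivlMr; last lra.
have -> : k = 2 / s - 1 by rewrite -s1; field; apply: lt0r_neq0.
have := sqr_ge0 s.
have -> : 2 * (s - s ^+ 2 / 2) * (2 / s - 1 + 1 + 1) = 4 - s ^+ 2.
  by field; apply: lt0r_neq0.
lra.
Qed.

Section SquareRoot.
Variables (H : hilbertSpace) (B : H -> H).
Hypothesis Blin : is_linear B.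
Hypothesis Bc : forall x, nsq (B x) <= nsq x.
Hypothesis Bsym : forall x y, inner (B x) y = inner x (B y).

Local Notation Y := (sqrt_iter B).
Local Notation y := sqrt_majorant.

Let half_nsq (x : H) : nsq (cR (1 / 2) *: x) = nsq x / 4.
Proof. by rewrite /nsq rinZl rinZr; field. Qed.

Lemma sqrt_iter_lin n : is_linear (Y n).
Proof.
elim: n => [|n IH] a x z /=; first by rewrite scaler0 addr0.
by rewrite Blin !IH !scalerDr !scalerA [cR _ * a]mulrC addrACA.
Qed.

Lemma sqrt_iter_sym n x z : inner (Y n x) z = inner x (Y n z).
Proof.
elim: n x z => [|n IH] x z /=; first by rewrite inner0l inner0r.
rewrite innerZl innerZr !innerDl !innerDr !IH Bsym.
by have -> : (cR (1 / 2))^* = cR (1 / 2) by apply: ReImC_eq; rewrite ?ReC_conj ?ImC_conj //= oppr0.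
Qed.

Lemma sqrt_iter_bound n x : nsq (Y n x) <= y n ^+ 2 * nsq x.
Proof.
elim: n x => [|n IH] x; first by rewrite /= /nsq rin0r; nra.
rewrite [Y _ _]/= half_nsq.
have /andP[y0 y1] := sqrt_majorant_itv n.
have : nsq (B x + Y n (Y n x)) <= (1 + y n ^+ 2) ^+ 2 * nsq x.
  apply: nsqD_bound; rewrite ?sqr_ge0 ?nsq_ge0 //; first by rewrite expr1n mul1r.
  apply: (le_trans (IH _)); rewrite [(y n ^+ 2) ^+ 2]expr2 -mulrA.
  by apply: ler_wpM2l; rewrite ?sqr_ge0.
rewrite /=; lra.
Qed.

(** Induction on Y_{n+1}^2 - Y_n^2 = Y_{n+1} (Y_{n+1} - Y_n) + (Y_{n+1} - Y_n) Y_n, halved; the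
    scalar increments satisfy the same identity. *)
Lemma sqrt_iter_step n x : nsq (Y n.+1 x - Y n x) <= (y n.+1 - y n) ^+ 2 * nsq x.
Proof.
elim: n x => [|n IH] x.
  have -> : Y 1 x - Y 0 x = cR (1 / 2) *: B x by rewrite /= subr0 addr0.
  by rewrite half_nsq /=; have := Bc x; lra.
have -> : Y n.+2 x - Y n.+1 x =
    cR (1 / 2) *: (Y n.+1 (Y n.+1 x - Y n x) + (Y n.+1 (Y n x) - Y n (Y n x))).
  rewrite (lin_B (sqrt_iter_lin n.+1)) subrKA.
  rewrite -[Y n.+2 x]/(_ *: (_ + _)) -[X in _ - X]/(_ *: (_ + _)) -scalerBr.
  by rewrite opprD addrACA subrr add0r.
rewrite half_nsq.
have /andP[a0 a1] := sqrt_majorant_itv n; have /andP[b0 b1] := sqrt_majorant_itv n.+1.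
have ab := sqrt_majorant_le n; have N0 := nsq_ge0 x.
set u := Y n.+1 _; set v := _ - Y n (Y n x).
have hu : nsq u <= (y n.+1 * (y n.+1 - y n)) ^+ 2 * nsq x.
  apply: (le_trans (sqrt_iter_bound _ _)).
  have := ler_wpM2l (sqr_ge0 (y n.+1)) (IH x); move: (y n.+1) (y n) => b a; lra.
have hv : nsq v <= ((y n.+1 - y n) * y n) ^+ 2 * nsq x.
  apply: (le_trans (IH _)).
  have := ler_wpM2l (sqr_ge0 (y n.+1 - y n)) (sqrt_iter_bound n x).
  move: (y n.+1) (y n) => b a; lra.
have ba : 0 <= y n.+1 - y n by rewrite subr_ge0.
have := nsqD_bound (mulr_ge0 b0 ba) (mulr_ge0 ba a0) N0 hu hv.
have -> : y n.+2 - y n.+1 = (y n.+1 ^+ 2 - y n ^+ 2) / 2 by rewrite /=; field.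
lra.
Qed.

Lemma sqrt_iter_dist n k x : nsq (Y (n + k) x - Y n x) <= (y (n + k) - y n) ^+ 2 * nsq x.
Proof.
elim: k => [|k IH]; first by rewrite addn0 subrr /nsq rin0r; nra.
rewrite addnS -(subrKA (Y (n + k) x)).
have mono : y n <= y (n + k).
  by elim: {IH}k => [|k IH]; rewrite ?addn0 // addnS (le_trans IH) // sqrt_majorant_le.
have st : 0 <= y (n + k).+1 - y (n + k) by rewrite subr_ge0 sqrt_majorant_le.
have mo : 0 <= y (n + k) - y n by rewrite subr_ge0.
have := nsqD_bound st mo (nsq_ge0 x) (sqrt_iter_step (n + k) x) IH.
by rewrite [in X in _ <= X]subrKA.
Qed.

Lemma sqrt_iter_cvg x : exists l, cvgH (fun n => Y n x) l.
Proof.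
apply: nsq_complete => e e0; have N0 := nsq_ge0 x.
(* With r = 1 / (n + 2), the majorant increments are at most 2 r <= 2, so their squares are at most
   4 r; the added 1 covers [nsq x = 0]. *)
have [|N NP] := @inv_nat_small (e / (4 * nsq x + 1)); first by rewrite divr_gt0 //; lra.
have key n k : (N <= n)%N -> nsq (Y (n + k) x - Y n x) < e.
  move=> Nn; apply: (le_lt_trans (sqrt_iter_dist _ _ _)).
  have := NP n.+1 (leqW Nn); have := sqrt_majorant_ge n.
  have /andP[_ yk1] := sqrt_majorant_itv (n + k).
  have yn : y n <= y (n + k).
    by elim: k {yk1} => [|k IH]; rewrite ?addn0 // addnS (le_trans IH) // sqrt_majorant_le.
  have r0 : 0 <= n.+2%:R^-1 :> R by rewrite invr_ge0.
  have r1 : n.+2%:R^-1 <= 1 :> R by rewrite invf_le1 // ler1n.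
  rewrite ltr_pdivlMr; last lra.
  move: (n.+2%:R^-1) (y (n + k)) (y n) r0 r1 yk1 yn => r a b r0 r1 a1 ab h1 h2.
  have h3 : a - b <= 2 * r by lra.
  have h4 : (a - b) ^+ 2 <= 4 * r by nra.
  by have := ler_wpM2r N0 h4; lra.
exists N => m n Nm Nn; case: (leqP m n) => [mn|/ltnW nm].
  by rewrite nsq_subC -(subnKC mn); exact: key.
by rewrite -(subnKC nm); exact: key.
Qed.

End SquareRoot.

(** [Y] is the pointwise limit of the iterates for B = T^* T, and inherits linearity and symmetry.
    The limit of the recursion is 2 Y = B + Y^2, so D = 1 - Y is symmetric with D^2 = 1 - B. *)
Lemma defect_operator (H : hilbertSpace) (T : H -> H) : contraction T ->
  exists D : H -> H, is_linear D /\
    forall x y, inner (D x) (D y) = inner x y - inner (T x) (T y).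
Proof.
move=> [[Tlin _] Tn]; have Tc x : nsq (T x) <= nsq x by rewrite -hnorm_le.
have [B [Blin Bc BT]] := bounded_form_operator Tlin Tc.
have Bsym x y : inner (B x) y = inner x (B y) by rewrite innerJ !BT -innerJ.
have /boolp.choice[Y YP] := sqrt_iter_cvg Blin Bc.
have Ylin : is_linear Y.
  move=> a x z; apply: (cvgH_unique (YP _)).
  have := cvgHD (cvgHZ a (YP x)) (YP z).
  by rewrite (_ : (fun n => _ + _) = (fun n => sqrt_iter B n (a *: x + z))) //;
    apply/funext => n; rewrite sqrt_iter_lin.
have Ysym x z : inner (Y x) z = inner x (Y z).
  have Yrin w w' : rin (Y w) w' = rin (Y w') w.
    by apply: (cvgH_rin_eq (YP _) (YP _)) => n; rewrite [RHS]rinC /rin sqrt_iter_sym.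
  rewrite !innerE; congr (Complex _ _); first by rewrite Yrin rinC.
  by rewrite Yrin rinC (lin_Z Ylin).
have Yfix x : Y x + Y x = B x + Y (Y x).
  have h : Y x = cR (1 / 2) *: (B x + Y (Y x)).
    apply: (cvgH_unique (cvgHS (YP x))); apply/cvgHZ/cvgHD; first exact: cvgH_cst.
    (* Y_n Y_n x - Y Y x splits as Y_n (Y_n x - Y x) + (Y_n - Y) (Y x), and each Y_n is a
       contraction. *)
    move=> e e0; have [|N NP] := cvgH_near2 (YP x) (YP (Y x)) (e := e / 4); first lra.
    exists N => n /NP[h1 h2].
    rewrite -(subrKA (sqrt_iter B n (Y x))) -(lin_B (sqrt_iter_lin Blin n)).
    apply: (le_lt_trans (nsqD_le _ _)).
    have := sqrt_iter_bound Bc n (sqrt_iter B n x - Y x).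
    have /andP[y0 y1] := sqrt_majorant_itv n.
    have := nsq_ge0 (sqrt_iter B n x - Y x).
    move: (nsq (sqrt_iter B n x - Y x)) (sqrt_majorant n) h1 y0 y1 => N' y h1 y0 y1 N0 h3.
    have : y ^+ 2 * N' <= N' by rewrite ler_piMl // expr_le1.
    lra.
  rewrite -[B x + _]scale1r {1 2}h -scalerDl; congr (_ *: _).
  by apply: ReImC_eq => /=; rewrite ?addr0 //; field.
exists (fun x => x - Y x); split=> [a x z|x z].
  by rewrite Ylin scalerBr opprD addrACA.
rewrite !innerDl !innerDr !innerNl !innerNr -BT !Ysym.
have := congr1 (inner x) (Yfix z); rewrite !innerDr => h.
move: (inner x (B z)) (inner x (Y (Y z))) (inner x (Y z)) h => b yy w h.
have -> : b = w + w - yy by rewrite h addrK.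
ring.
Qed.

(** * Direct sums and square-summable sequences *)

(** Lets completeness of the spaces built below be proved with real squared norms; it is stated for
    a bare form, since the [hilbertSpace] is not yet available there. *)
Lemma complete_sqrtC (V : lmodType C) (ip : V -> V -> C) : (forall x, 0 <= ip x x) ->
  (forall u : nat -> V,
    (forall e : R, 0 < e -> exists N, forall m n, (N <= m)%N -> (N <= n)%N ->
       ReC (ip (u m - u n) (u m - u n)) < e) ->
    exists l, forall e : R, 0 < e -> exists N, forall n, (N <= n)%N ->
       ReC (ip (u n - l) (u n - l)) < e) ->
  forall u : nat -> V,
    (forall e : C, 0 < e -> exists N : nat, forall m n : nat,
        (N <= m)%N -> (N <= n)%N -> sqrtC (ip (u m - u n) (u m - u n)) < e) ->
    exists l : V, forall e : C, 0 < e -> exists N : nat, forall n : nat,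
        (N <= n)%N -> sqrtC (ip (u n - l) (u n - l)) < e.
Proof.
move=> ip0 cpl u cu; have [e e0|l lP] := cpl u.
  have se0 : 0 < Num.sqrt e by rewrite sqrtr_gt0.
  have [|N NP] := cu (cR (Num.sqrt e)); first by rewrite (lt_cR 0).
  exists N => m n Nm Nn; have := NP m n Nm Nn.
  by rewrite sqrtC_lt_cR // sqr_sqrtr // ltW.
exists l => e e0; move: (e0); rewrite (ge0_cR (ltW e0)) (lt_cR 0) => r0.
have [N NP] := lP (ReC e ^+ 2) (exprn_gt0 _ r0).
by exists N => n /NP; rewrite sqrtC_lt_cR.
Qed.

(** * Orthogonal sum of two Hilbert spaces *)

Section Product.
Variables H K : hilbertSpace.

Definition prod_inner (x y : H * K) : C := inner x.1 y.1 + inner x.2 y.2.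

Lemma prod_innerDZl a (x y z : H * K) :
  prod_inner (a *: x + y) z = a * prod_inner x z + prod_inner y z.
Proof. by rewrite /prod_inner /= !innerDl !innerZl mulrDr addrACA. Qed.

Lemma prod_innerC (x y : H * K) : prod_inner y x = (prod_inner x y)^*.
Proof. by rewrite /prod_inner innerJ [inner y.2 _]innerJ rmorphD. Qed.

Lemma prod_inner_ge0 (x : H * K) : 0 <= prod_inner x x.
Proof. by apply: addr_ge0; exact: hs_inner_ge0. Qed.

Lemma prod_inner_eq0 (x : H * K) : prod_inner x x = 0 -> x = 0.
Proof.
move=> /eqP; rewrite paddr_eq0 ?hs_inner_ge0 // => /andP[/eqP h1 /eqP h2].
by rewrite [x]surjective_pairing (hs_inner_eq0 h1) (hs_inner_eq0 h2).
Qed.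

Lemma prod_complete (u : nat -> H * K) :
    (forall e : R, 0 < e -> exists N, forall m n, (N <= m)%N -> (N <= n)%N ->
       ReC (prod_inner (u m - u n) (u m - u n)) < e) ->
    exists l, forall e : R, 0 < e -> exists N, forall n, (N <= n)%N ->
       ReC (prod_inner (u n - l) (u n - l)) < e.
Proof.
move=> cu.
have [e e0|l1 l1P] := @nsq_complete H (fun n => (u n).1).
  have [N NP] := cu e e0; exists N => m n Nm Nn; apply: le_lt_trans (NP m n Nm Nn).
  by rewrite ReCD lerDl; exact: nsq_ge0.
have [e e0|l2 l2P] := @nsq_complete K (fun n => (u n).2).
  have [N NP] := cu e e0; exists N => m n Nm Nn; apply: le_lt_trans (NP m n Nm Nn).
  by rewrite ReCD lerDr; exact: nsq_ge0.
exists (l1, l2) => e e0.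
have [|N1 h1] := l1P (e / 2); first lra.
have [|N2 h2] := l2P (e / 2); first lra.
exists (maxn N1 N2) => n; rewrite geq_max => /andP[/h1 {}h1 /h2 {}h2].
by rewrite ReCD -/(rin _ _) -/(nsq _) -/(rin _ _) -/(nsq _) /=; lra.
Qed.

Definition prodH : hilbertSpace :=
  HilbertSpace prod_innerDZl prod_innerC prod_inner_ge0 prod_inner_eq0
    (complete_sqrtC prod_inner_ge0 prod_complete).

Lemma inner_prodE (x y : prodH) : inner x y = inner x.1 y.1 + inner x.2 y.2.
Proof. by []. Qed.

Lemma nsq_prodE (x : prodH) : nsq x = nsq x.1 + nsq x.2.
Proof. by rewrite /nsq /rin inner_prodE ReCD. Qed.

End Product.

(** * Limits of complex sequences *)

Section ComplexLimits.
Let RR : realType := R.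

(** Encoded by real and imaginary parts so that the limit theorems for real sequences apply. *)
Definition cvgC (u : nat -> C) (l : C) : Prop :=
  (((fun n => ReC (u n) : RR) @ \oo --> (ReC l : RR)) /\
   ((fun n => ImC (u n) : RR) @ \oo --> (ImC l : RR)))%classic.

Lemma cvgC_unique u l m : cvgC u l -> cvgC u m -> l = m.
Proof.
by move=> [a b] [c d]; apply: ReImC_eq; [exact: (cvg_unique _ a c)|exact: (cvg_unique _ b d)].
Qed.

Lemma cvgCD u v l m : cvgC u l -> cvgC v m -> cvgC (fun n => u n + v n) (l + m).
Proof.
move=> [a b] [c d]; split.
  by rewrite ReCD; under eq_fun do rewrite ReCD; exact: cvgD.
by rewrite ImCD; under eq_fun do rewrite ImCD; exact: cvgD.
Qed.

Lemma cvgCZ a u l : cvgC u l -> cvgC (fun n => a * u n) (a * l).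
Proof.
move=> [ul1 ul2]; split.
  rewrite ReCM; under eq_fun do rewrite ReCM.
  by apply: cvgB; apply: cvgM => //; exact: cvg_cst.
rewrite ImCM; under eq_fun do rewrite ImCM.
by apply: cvgD; apply: cvgM => //; exact: cvg_cst.
Qed.

Lemma cvgC_conj u l : cvgC u l -> cvgC (fun n => (u n)^*) l^*.
Proof.
move=> [ul1 ul2]; split.
  by rewrite ReC_conj; under eq_fun do rewrite ReC_conj.
by rewrite ImC_conj; under eq_fun do rewrite ImC_conj; exact: cvgN.
Qed.

Lemma cvgC_cst l : cvgC (fun=> l) l.
Proof. by split; exact: cvg_cst. Qed.

Lemma cvgC_shift u l : cvgC (fun n => u n.+1) l -> cvgC u l.
Proof. by move=> [a b]; split; rewrite -cvg_shiftS. Qed.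

Lemma cvgC_Re_le u l (M : R) : cvgC u l -> (forall n, ReC (u n) <= M) -> ReC l <= M.
Proof.
by move=> [a _] uM; apply: (cvgr_to_le a); exact: nearW.
Qed.

Lemma cvgC_Re_ge u l (M : R) N : cvgC u l -> (forall n, (N <= n)%N -> M <= ReC (u n)) ->
  M <= ReC l.
Proof. by move=> [a _] uM; apply: (cvgr_to_ge a); exists N. Qed.

Lemma bounded_series_cvg (f : nat -> RR) (M : R) :
  (forall n, 0 <= f n) -> (forall n, \sum_(i < n) f i <= M) ->
  exists l : RR, ((fun n => \sum_(i < n) f i) @ \oo --> l)%classic.
Proof.
move=> f0 fM.
have : cvgn (fun n => \sum_(i < n) f i).
  apply: nondecreasing_is_cvgn.
    apply/nondecreasing_seqP => n; by rewrite big_ord_recr /= lerDl.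
  by exists M => _ [n _ <-].
by move=> h; exists (limn (fun n => \sum_(i < n) f i)).
Qed.

End ComplexLimits.

(** * The Hilbert space of square-summable sequences *)

Section SquareSummable.
Variable F : hilbertSpace.

Definition square_summable (x : nat -> F) : Prop :=
  exists M : R, forall n, \sum_(i < n) nsq (x i) <= M.

(** A boolean predicate, so that the vector space structure of [l2] comes from the submodule
    construction. *)
Definition l2_pred : {pred nat -> F} := fun x => `[< square_summable x >].

Lemma l2_predP (x : nat -> F) : reflect (square_summable x) (x \in l2_pred).
Proof. exact: asboolP. Qed.

Lemma l2_pred_submod : submod_closed l2_pred.
Proof.
split=> [|a x y /l2_predP[M xM] /l2_predP[M' yM']]; apply/l2_predP.
  by exists 0 => n; rewrite big1 // => i _; rewrite /nsq rin0r.
set c := ReC a ^+ 2 + ImC a ^+ 2.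
have c0 : 0 <= c by rewrite addr_ge0 ?sqr_ge0.
exists (2 * (c * M) + 2 * M') => n.
apply: (@le_trans _ _ (\sum_(i < n) (2 * (c * nsq (x i)) + 2 * nsq (y i)))).
  by apply: ler_sum => i _; apply: (le_trans (nsqD_le _ _)); rewrite nsqZ.
rewrite big_split /= -!mulr_sumr.
by have := ler_wpM2l c0 (xM n); have := yM' n; lra.
Qed.

HB.instance Definition _ := GRing.isSubmodClosed.Build C (nat -> F) l2_pred l2_pred_submod.

Record l2 := L2 { l2_seq :> nat -> F; l2_seqP : l2_seq \in l2_pred }.

HB.instance Definition _ := [isSub for l2_seq].
HB.instance Definition _ := [Choice of l2 by <:].
HB.instance Definition _ := [SubChoice_isSubLmodule of l2 by <:].

Lemma l2_ext (x y : l2) : (forall n, x n = y n) -> x = y.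
Proof. by move=> xy; apply/val_inj/funext. Qed.

Lemma l2_linE a (x y : l2) n : (a *: x + y) n = a *: x n + y n.
Proof. by []. Qed.
Lemma l2_subE (x y : l2) n : (x - y) n = x n - y n.
Proof. by []. Qed.

End SquareSummable.

Lemma cvg_sub_div4 (RR : realType) (f g : nat -> RR) (l m : RR) :
  (f @ \oo --> l -> g @ \oo --> m -> (fun n => (f n - g n) / 4) @ \oo --> (l - m) / 4)%classic.
Proof. by move=> fl gm; apply: cvgM; [exact: cvgB|exact: cvg_cst]. Qed.

Section L2Space.
Variable F : hilbertSpace.
Implicit Types x y z : l2 F.

Lemma rin_polar (H : hilbertSpace) (a b : H) : rin a b = (nsq (a + b) - nsq (a - b)) / 4.
Proof. by rewrite !nsqD nsqN rinNr; field. Qed.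

(** Polarisation writes the series as a difference of two series with non-negative terms and bounded
    partial sums. *)
Lemma rin_series_cvg x y :
  exists l : (R : realType), ((fun n => \sum_(i < n) rin (x i) (y i)) @ \oo --> l)%classic.
Proof.
have nsq_series_cvg z :
    exists l : (R : realType), ((fun n => \sum_(i < n) nsq (z i)) @ \oo --> l)%classic.
  have /l2_predP[M zM] := l2_seqP z.
  exact: (@bounded_series_cvg (fun i => nsq (z i)) M (fun i => nsq_ge0 (z i)) zM).
have [l1 h1] := nsq_series_cvg (x + y); have [l2 h2] := nsq_series_cvg (x - y).
exists ((l1 - l2) / 4).
have -> : (fun n => \sum_(i < n) rin (x i) (y i)) =
    (fun n => (\sum_(i < n) nsq ((x + y) i) - \sum_(i < n) nsq ((x - y) i)) / 4).
  apply/funext => n; rewrite -sumrB mulr_suml; apply: eq_bigr => i _.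
  by rewrite rin_polar.
exact: cvg_sub_div4.
Qed.

Lemma inner_series_cvg x y :
  exists l, cvgC (fun n => \sum_(i < n) inner (x i) (y i)) l.
Proof.
have [a ha] := rin_series_cvg x y; have [b hb] := rin_series_cvg x (iC *: y).
exists (a +i* b)%C; split.
  by under eq_fun do rewrite (ReC_sum _ (fun i => inner (x i) (y i))).
under eq_fun do rewrite (ImC_sum _ (fun i => inner (x i) (y i))).
rewrite (_ : (fun n => _) = (fun n => \sum_(i < n) rin (x i) ((iC *: y) i))) //.
by apply/funext => n; apply: eq_bigr => i _; rewrite innerE.
Qed.

Definition l2_inner x y : C := sval (cid (inner_series_cvg x y)).

Lemma l2_inner_cvg x y : cvgC (fun n => \sum_(i < n) inner (x i) (y i)) (l2_inner x y).
Proof. exact: svalP (cid (inner_series_cvg x y)). Qed.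

Lemma l2_innerDZl a x y z : l2_inner (a *: x + y) z = a * l2_inner x z + l2_inner y z.
Proof.
apply: (cvgC_unique (l2_inner_cvg _ _)).
have := cvgCD (cvgCZ a (l2_inner_cvg x z)) (l2_inner_cvg y z).
rewrite (_ : (fun n => _ + _) = (fun n => \sum_(i < n) inner ((a *: x + y) i) (z i))) //.
apply/funext => n; rewrite mulr_sumr -big_split; apply: eq_bigr => i _.
by rewrite l2_linE innerDl innerZl.
Qed.

Lemma l2_innerC x y : l2_inner y x = (l2_inner x y)^*.
Proof.
apply: (cvgC_unique (l2_inner_cvg _ _)).
have := cvgC_conj (l2_inner_cvg x y).
rewrite (_ : (fun n => _^*) = (fun n => \sum_(i < n) inner (y i) (x i))) //.
by apply/funext => n; rewrite rmorph_sum; apply: eq_bigr => i _; rewrite [RHS]innerJ.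
Qed.

Lemma l2_partial_le x n : \sum_(i < n) nsq (x i) <= ReC (l2_inner x x).
Proof.
apply: (cvgC_Re_ge (N := n) (l2_inner_cvg x x)) => m nm.
rewrite (ReC_sum _ (fun i => inner (x i) (x i))) -(subnKC nm) big_split_ord /= lerDl.
by apply: sumr_ge0 => i _; exact: nsq_ge0.
Qed.

Lemma l2_bound_le x M : (forall n, \sum_(i < n) nsq (x i) <= M) -> ReC (l2_inner x x) <= M.
Proof.
move=> xM; apply: (cvgC_Re_le (l2_inner_cvg x x)) => n.
by rewrite (ReC_sum _ (fun i => inner (x i) (x i))); exact: xM.
Qed.

Lemma l2_inner_ge0 x : 0 <= l2_inner x x.
Proof.
have re0 : 0 <= ReC (l2_inner x x) by have := l2_partial_le x 0; rewrite big_ord0.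
have -> : l2_inner x x = cR (ReC (l2_inner x x)); last by rewrite (le_cR 0).
apply: ReImC_eq => //=; apply/eqP.
have := congr1 ImC (l2_innerC x x); rewrite ImC_conj => /eqP.
by rewrite -addr_eq0 -mulr2n mulrn_eq0.
Qed.

Lemma l2_inner_eq0 x : l2_inner x x = 0 -> x = 0.
Proof.
move=> x0; apply: l2_ext => n; apply: nsq_eq0; apply: le_anti; rewrite nsq_ge0 andbT.
have := l2_partial_le x n.+1; rewrite x0 big_ord_recr /=; apply: le_trans.
by rewrite lerDr sumr_ge0 // => i _; exact: nsq_ge0.
Qed.

Lemma l2_coord_le x i : nsq (x i) <= ReC (l2_inner x x).
Proof.
have := l2_partial_le x i.+1; rewrite big_ord_recr /=; apply: le_trans.
by rewrite lerDr sumr_ge0 // => j _; exact: nsq_ge0.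
Qed.

Lemma l2_complete (u : nat -> l2 F) :
    (forall e : R, 0 < e -> exists N, forall m n, (N <= m)%N -> (N <= n)%N ->
       ReC (l2_inner (u m - u n) (u m - u n)) < e) ->
    exists l, forall e : R, 0 < e -> exists N, forall n, (N <= n)%N ->
       ReC (l2_inner (u n - l) (u n - l)) < e.
Proof.
move=> cu.
have /boolp.choice[v vP] i : exists l, cvgH (fun n => u n i) l.
  apply: nsq_complete => e /cu[N NP]; exists N => m n Nm Nn.
  by apply: le_lt_trans (NP m n Nm Nn); rewrite -l2_subE l2_coord_le.
(* The finitely many coordinates [i < n] are compared with those of one late [u m]. *)
have key e : 0 < e -> exists N, forall k, (N <= k)%N ->
    forall n, \sum_(i < n) nsq (u k i - v i) <= 4 * e.
  move=> e0; have [N NP] := cu e e0; exists N => k Nk n.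
  have [m Nm mP] : exists2 m, (N <= m)%N & \sum_(i < n) nsq (u m i - v i) <= e.
    have n1 : 0 < n.+1%:R :> R by rewrite ltr0n.
    have [m0 m0P] : exists m0, forall m, (m0 <= m)%N -> forall i, (i < n)%N ->
        nsq (u m i - v i) < e / n.+1%:R.
      elim: {1}n => [|n' [m0 IH]]; first by exists 0%N.
      have [m1 h1] := vP n' _ (divr_gt0 e0 n1).
      exists (maxn m0 m1) => m; rewrite geq_max => /andP[a b] i.
      by rewrite ltnS leq_eqVlt => /predU1P[->|]; [exact: h1|exact: IH].
    exists (maxn N m0); first exact: leq_maxl.
    apply: (@le_trans _ _ (\sum_(i < n) (e / n.+1%:R))).
      by apply: ler_sum => i _; apply/ltW/m0P => //; exact: leq_maxr.
    rewrite sumr_const card_ord -[_ *+ n]mulr_natr -mulrA ler_piMr ?ltW //.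
    by rewrite ltr_pdivrMl // mulr1 ltr_nat.
  have h := ltW (NP k m Nk Nm).
  apply: (@le_trans _ _ (\sum_(i < n) (2 * nsq ((u k - u m) i) + 2 * nsq (u m i - v i)))).
    by apply: ler_sum => i _; rewrite l2_subE -(subrKA (u m i)); exact: nsqD_le.
  by rewrite big_split /= -!mulr_sumr; have := l2_partial_le (u k - u m) n; lra.
(* Bounded distance to the single element [u N] already makes the coordinatewise limit
   square-summable. *)
have vl2 : v \in @l2_pred F.
  have [N NP] := key 1 ltr01; apply/l2_predP.
  have /l2_predP[M MP] := l2_seqP (u N).
  exists (2 * M + 2 * 4) => n.
  apply: (@le_trans _ _ (\sum_(i < n) (2 * nsq (u N i) + 2 * nsq (u N i - v i)))).
    apply: ler_sum => i _; rewrite (nsq_subC (u N i)) -{1}(subrKC (u N i) (v i)).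
    exact: nsqD_le.
  by rewrite big_split /= -!mulr_sumr; have := NP N (leqnn N) n; have := MP n; lra.
exists (L2 vl2) => e e0; have [|N NP] := key (e / 8); first lra.
exists N => k Nk; apply: (@le_lt_trans _ _ (4 * (e / 8))); last lra.
by apply: l2_bound_le => n; exact: NP.
Qed.

Definition l2H : hilbertSpace :=
  HilbertSpace l2_innerDZl l2_innerC l2_inner_ge0 l2_inner_eq0
    (complete_sqrtC l2_inner_ge0 l2_complete).

End L2Space.

Arguments inner : simpl never.

(** * Shifts and coordinatewise unitaries on sequences *)

Section Sequences.
Variable E : hilbertSpace.
Local Notation L := (l2H E).

Definition cons_seq (a : E) (x : nat -> E) (n : nat) : E := if n is m.+1 then x m else a.

Lemma cons_seq_l2 (a : E) (x : l2 E) : cons_seq a x \in @l2_pred E.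
Proof.
apply/l2_predP; have /l2_predP[M xM] := l2_seqP x; exists (nsq a + M) => -[|n].
  by have := xM 0%N; rewrite !big_ord0 => M0; rewrite addr_ge0 ?nsq_ge0.
by rewrite big_ord_recl /= lerD2l; exact: xM.
Qed.

Lemma tail_seq_l2 (x : l2 E) : (fun n => x n.+1) \in @l2_pred E.
Proof.
apply/l2_predP; have /l2_predP[M xM] := l2_seqP x; exists M => n.
by apply: (le_trans _ (xM n.+1)); rewrite big_ord_recl /= lerDr nsq_ge0.
Qed.

Definition l2_cons (a : E) (x : L) : L := L2 (cons_seq_l2 a x).
Definition l2_tail (x : L) : L := L2 (tail_seq_l2 x).
Definition l2_coord (x : L) (n : nat) : E := l2_seq x n.

Lemma l2_coord_lin n : is_linear (fun x => l2_coord x n).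
Proof. by []. Qed.

Lemma l2_coord_ext (x y : L) : (forall n, l2_coord x n = l2_coord y n) -> x = y.
Proof. exact: l2_ext. Qed.

Lemma l2_consK a x : l2_tail (l2_cons a x) = x.
Proof. by apply: l2_coord_ext. Qed.

Lemma l2_cons_head x : l2_cons (l2_coord x 0) (l2_tail x) = x.
Proof. by apply: l2_coord_ext => -[|n]. Qed.

Lemma l2_cons_lin s a b x y : l2_cons (s *: a + b) (s *: x + y) = s *: l2_cons a x + l2_cons b y.
Proof. by apply: l2_coord_ext => -[|n]. Qed.

Lemma l2_tail_lin : is_linear l2_tail.
Proof. by move=> s x y; apply: l2_coord_ext. Qed.

Lemma inner_l2_cvg (x y : L) :
  cvgC (fun n => \sum_(i < n) inner (l2_coord x i) (l2_coord y i)) (inner x y).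
Proof. exact: l2_inner_cvg. Qed.

Lemma inner_l2_cons a b x y : inner (l2_cons a x) (l2_cons b y) = inner a b + inner x y.
Proof.
apply: (cvgC_unique (inner_l2_cvg _ _)); apply: cvgC_shift.
have := cvgCD (cvgC_cst (inner a b)) (inner_l2_cvg x y).
rewrite (_ : (fun n => inner a b + _) = (fun n => \sum_(i < n.+1)
  inner (l2_coord (l2_cons a x) i) (l2_coord (l2_cons b y) i))) //.
by apply/funext => n; rewrite big_ord_recl.
Qed.

Lemma inner_l2_head_tail x y :
  inner x y = inner (l2_coord x 0) (l2_coord y 0) + inner (l2_tail x) (l2_tail y).
Proof. by rewrite -inner_l2_cons !l2_cons_head. Qed.

Definition pair_coord (x : prodH L L) (n : nat) : prodH E E :=
  (l2_coord x.1 n, l2_coord x.2 n).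

Lemma pair_coord_ext x y : (forall n, pair_coord x n = pair_coord y n) -> x = y.
Proof.
move=> xy; rewrite [x]surjective_pairing [y]surjective_pairing.
by congr pair; apply: l2_coord_ext => n; case: (xy n).
Qed.

Lemma pair_coord_lin n : is_linear (fun x => pair_coord x n).
Proof. by []. Qed.

(** Each [g n] may mix the two channels but preserves the norm of the pair, so square-summability
    survives; the inner product is preserved partial sum by partial sum. *)
Lemma diagonal_iso (g g' : nat -> prodH E E -> prodH E E) :
  (forall n, hilbert_iso (g n) (g' n)) ->
  exists D D' : prodH L L -> prodH L L, hilbert_iso D D' /\
    forall x n, pair_coord (D x) n = g n (pair_coord x n).
Proof.
have ex (f : nat -> prodH E E -> prodH E E) : (forall n x, nsq (f n x) = nsq x) ->
    forall x, exists y, forall n, pair_coord y n = f n (pair_coord x n).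
  move=> fn x; have /l2_predP[M1 h1] := l2_seqP x.1; have /l2_predP[M2 h2] := l2_seqP x.2.
  have fle n : nsq (f n (pair_coord x n)).1 + nsq (f n (pair_coord x n)).2 <=
      nsq (l2_coord x.1 n) + nsq (l2_coord x.2 n).
    by rewrite -nsq_prodE fn nsq_prodE.
  have p1 : (fun n => (f n (pair_coord x n)).1) \in @l2_pred E.
    apply/l2_predP; exists (M1 + M2) => n; apply: (le_trans _ (lerD (h1 n) (h2 n))).
    rewrite -big_split; apply: ler_sum => i _; apply: (le_trans _ (fle i)).
    by rewrite lerDl nsq_ge0.
  have p2 : (fun n => (f n (pair_coord x n)).2) \in @l2_pred E.
    apply/l2_predP; exists (M1 + M2) => n; apply: (le_trans _ (lerD (h1 n) (h2 n))).
    rewrite -big_split; apply: ler_sum => i _; apply: (le_trans _ (fle i)).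
    by rewrite lerDr nsq_ge0.
  by exists (L2 p1, L2 p2) => n; rewrite [RHS]surjective_pairing.
have iso_nsq f f' : hilbert_iso f f' -> forall x : prodH E E, nsq (f x) = nsq x.
  by case=> _ fin _ _ x; rewrite /nsq /rin fin.
move=> gg'.
have /boolp.choice[D DP] := ex g (fun n => iso_nsq _ _ _ (gg' n)).
have /boolp.choice[D' DP'] := ex g' (fun n => iso_nsq _ _ _ (hilbert_iso_sym (gg' n))).
exists D, D'; split=> //; split.
- move=> s x y; apply: pair_coord_ext => n.
  by rewrite pair_coord_lin !DP pair_coord_lin (iso_lin (gg' n)).
- move=> x y; rewrite !inner_prodE.
  have cv (u v : prodH L L) := cvgCD (inner_l2_cvg u.1 v.1) (inner_l2_cvg u.2 v.2).
  apply: (cvgC_unique (cv _ _)); have := cv x y.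
  rewrite (_ : (fun n => _ + _) = (fun n =>
    \sum_(i < n) inner (l2_coord (D x).1 i) (l2_coord (D y).1 i) +
    \sum_(i < n) inner (l2_coord (D x).2 i) (l2_coord (D y).2 i))) //.
  apply/funext => n; rewrite -!big_split; apply: eq_bigr => i _ /=.
  have := iso_inner (gg' i) (pair_coord x i) (pair_coord y i).
  by rewrite -!DP !inner_prodE => /esym.
- by move=> x; apply: pair_coord_ext => n; rewrite DP' DP (isoK (gg' n)).
- by move=> x; apply: pair_coord_ext => n; rewrite DP DP' (isoKV (gg' n)).
Qed.

End Sequences.

(** * Unitaries on direct sums *)

Lemma hilbert_iso_prod (H K H' K' : hilbertSpace) (U : H -> H') V (U' : K -> K') V' :
  hilbert_iso U V -> hilbert_iso U' V' ->
  hilbert_iso (fun z : prodH H K => (U z.1, U' z.2) : prodH H' K')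
              (fun z : prodH H' K' => (V z.1, V' z.2) : prodH H K).
Proof.
move=> [a b c d] [a' b' c' d']; split=> [s x y|x y|[x y]|[x y]].
- by rewrite /= a a'.
- by rewrite !inner_prodE b b'.
- by rewrite /= c c'.
- by rewrite /= d d'.
Qed.

(** The isometries h |-> (h, 0) and h |-> (0, (T h, D h)) have orthogonal ranges thanks to the third
    copy of [H], so a reflection exchanges them; the cyclic permutation [p] then puts [T h] in
    front. *)
Lemma julia_iso (H : hilbertSpace) (T : H -> H) : contraction T ->
  exists (D : H -> H) (J J' : prodH H (prodH H H) -> prodH H (prodH H H)),
    [/\ is_linear D, forall x y, inner (D x) (D y) = inner x y - inner (T x) (T y),
        hilbert_iso J J' & forall h, J (h, 0) = (T h, (D h, 0))].
Proof.
move=> Tc; have [D [Dlin DT]] := defect_operator Tc.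
have Tlin : is_linear T by case: Tc => [[]].
pose N := prodH H (prodH H H).
have [||||G [Giso Gab]] := @exchange_reflection H N (fun h => (h, 0)) (fun h => (0, (T h, D h))).
- by move=> s x y; congr pair; rewrite /= scaler0 addr0.
- by move=> s x y; rewrite Tlin Dlin; congr pair; rewrite /= scaler0 addr0.
- by move=> h k; rewrite !inner_prodE /= !inner0l DT; ring.
- by move=> h k; rewrite !inner_prodE /= !inner0l inner0r !addr0.
pose p (z : N) : N := (z.2.1, (z.2.2, z.1)).
pose p' (z : N) : N := (z.2.2, (z.1, z.2.1)).
have piso : hilbert_iso p p'.
  split=> // [x y|[x [y z]]|[x [y z]]] //.
  by rewrite !inner_prodE /=; ring.
exists D, (p \o G), (G \o p'); split=> //; first exact: hilbert_iso_comp Giso piso.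
by move=> h /=; rewrite Gab.
Qed.

(** A unitary fixing [H] pointwise preserves orthogonality to [H], hence maps [F] into itself; the
    same for the inverse makes the restriction unitary. *)
Lemma iso_fixing_summand (H F : hilbertSpace) (Z Z' : prodH H F -> prodH H F) :
  hilbert_iso Z Z' -> (forall h, Z (h, 0) = (h, 0)) ->
  exists g g' : F -> F, hilbert_iso g g' /\ forall h f, Z (h, f) = (h, g f).
Proof.
have main (V V' : prodH H F -> prodH H F) : hilbert_iso V V' -> (forall h, V (h, 0) = (h, 0)) ->
    forall h f, V (h, f) = (h, (V (0, f)).2).
  move=> Viso Vfix h f.
  have V0 : (V (0, f)).1 = 0.
    apply: ext_inner => k; rewrite inner0r.
    have := iso_inner Viso (k, 0) (0, f); rewrite Vfix !inner_prodE /=.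
    by rewrite !inner0l inner0r !addr0.
  have -> : (h, f) = (1 : C) *: ((h, 0) : prodH H F) + (0, f).
    by congr pair; rewrite /= scale1r ?addr0 ?add0r.
  rewrite (iso_lin Viso) Vfix scale1r; congr pair => /=; last by rewrite add0r.
  by rewrite V0 addr0.
move=> Ziso Zfix.
have Zfix' h : Z' (h, 0) = (h, 0) by rewrite -{1}Zfix (isoK Ziso).
have Z1 := main _ _ Ziso Zfix; have Z2 := main _ _ (hilbert_iso_sym Ziso) Zfix'.
exists (fun f => (Z (0, f)).2), (fun f => (Z' (0, f)).2); split=> //; split.
- move=> s x y.
  have := iso_lin Ziso s (0, x) (0, y).
  by rewrite [Z (0, x)]Z1 [Z (0, y)]Z1 => /(congr1 snd) /= <-; congr (Z _).2; congr pair;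
    rewrite /= scaler0 addr0.
- move=> x y; have := iso_inner Ziso (0, x) (0, y).
  by rewrite [Z (0, x)]Z1 [Z (0, y)]Z1 !inner_prodE /= !inner0l !add0r.
- by move=> x; have := isoK Ziso (0, x); rewrite [Z (0, x)]Z1 => ->.
- by move=> x; have := isoKV Ziso (0, x); rewrite [Z' (0, x)]Z2 => ->.
Qed.

(** * The dilation space *)

Lemma prod_ext (H K : hilbertSpace) (x y : prodH H K) : x.1 = y.1 -> x.2 = y.2 -> x = y.
Proof. by case: x y => [a b] [c d] /= -> ->. Qed.

Lemma prod_lin1 (H K : hilbertSpace) s (x y : prodH H K) : (s *: x + y).1 = s *: x.1 + y.1.
Proof. by []. Qed.

Lemma prod_lin2 (H K : hilbertSpace) s (x y : prodH H K) : (s *: x + y).2 = s *: x.2 + y.2.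
Proof. by []. Qed.

Lemma pair_lin (H K : hilbertSpace) s (a c : H) (b d : K) :
  s *: ((a, b) : prodH H K) + ((c, d) : prodH H K) = (s *: a + c, s *: b + d).
Proof. by []. Qed.

Section Scattering.
Variables H E : hilbertSpace.
Local Notation L := (l2H E).
Local Notation K := (prodH H (prodH (prodH L L) (prodH L L))).
Local Notation HF := (prodH H (prodH E E)).

(* An element [(h, (x, y))] of [K] has incoming part [x] and outgoing part [y], each
   made of two channels with values in [E]. *)
Definition in_slot (z : K) : prodH H E := (z.1, l2_coord z.2.1.1 0).
Definition out_slot (z : K) : prodH H E := (z.1, l2_coord z.2.2.1 0).

Definition advance (p : prodH H E) (z : K) : K :=
  (p.1, ((l2_tail z.2.1.1, z.2.1.2), (l2_cons p.2 z.2.2.1, z.2.2.2))).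
Definition retreat (p : prodH H E) (z : K) : K :=
  (p.1, ((l2_cons p.2 z.2.1.1, z.2.1.2), (l2_tail z.2.2.1, z.2.2.2))).

Definition channel1 (J : prodH H E -> prodH H E) (z : K) : K := advance (J (in_slot z)) z.
Definition channel1_inv (J : prodH H E -> prodH H E) (z : K) : K := retreat (J (out_slot z)) z.

Lemma in_slot_lin : is_linear in_slot.
Proof.
by move=> s x y; rewrite /in_slot pair_lin !(prod_lin1, prod_lin2) l2_coord_lin.
Qed.

Lemma advance_lin s p q x y :
  advance (s *: p + q) (s *: x + y) = s *: advance p x + advance q y.
Proof.
by rewrite /advance !pair_lin !(prod_lin1, prod_lin2) l2_tail_lin l2_cons_lin.
Qed.

Definition swap_channels (z : K) : K :=
  (z.1, ((z.2.1.2, z.2.1.1), (z.2.2.2, z.2.2.1))).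

Definition local1 (J : prodH H E -> prodH H E) (z : HF) : HF :=
  let p := J (z.1, z.2.1) in (p.1, (p.2, z.2.2)).

Definition swap_local (z : HF) : HF := (z.1, (z.2.2, z.2.1)).

Definition channel2 J := swap_channels \o channel1 J \o swap_channels.
Definition channel2_inv J := swap_channels \o channel1_inv J \o swap_channels.
Definition local2 J := swap_local \o local1 J \o swap_local.

Definition full_shift (A : HF -> HF) (z : K) : K :=
  let p := A (z.1, pair_coord z.2.1 0) in
  (p.1, ((l2_tail z.2.1.1, l2_tail z.2.1.2),
         (l2_cons p.2.1 z.2.2.1, l2_cons p.2.2 z.2.2.2))).

(** The channels use disjoint coordinates and meet only in [H], so one step of each is a
    simultaneous shift with the composed local operator. *)
Lemma channel21 J1 J2 z :
  channel2 J2 (channel1 J1 z) = full_shift (local2 J2 \o local1 J1) z.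
Proof. by []. Qed.

Lemma channel12 J1 J2 z :
  channel1 J1 (channel2 J2 z) = full_shift (local1 J1 \o local2 J2) z.
Proof. by []. Qed.

Lemma local1_iso J J' : hilbert_iso J J' -> hilbert_iso (local1 J) (local1 J').
Proof.
move=> Ji; split=> [s x y|x y|[h [e f]]|[h [e f]]].
- have := iso_lin Ji s (x.1, x.2.1) (y.1, y.2.1) => Jl.
  by rewrite /local1 [J _]Jl.
- rewrite /local1 !inner_prodE /= !addrA -!inner_prodE.
  have := iso_inner Ji (x.1, x.2.1) (y.1, y.2.1); rewrite inner_prodE /= => ->.
  by rewrite inner_prodE.
- by rewrite /local1 /= -surjective_pairing (isoK Ji).
- by rewrite /local1 /= -surjective_pairing (isoKV Ji).
Qed.

Lemma local1E J h t d f : J (h, 0) = (t, d) -> local1 J (h, (0, f)) = (t, (d, f)).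
Proof. by move=> JE; rewrite /local1 /= JE. Qed.

Lemma local2E J h t d e : J (h, 0) = (t, d) -> local2 J (h, (e, 0)) = (t, (e, d)).
Proof. by move=> JE; rewrite /local2 /= /local1 /swap_local /= JE. Qed.

Lemma channel1_iso J J' : hilbert_iso J J' -> hilbert_iso (channel1 J) (channel1_inv J').
Proof.
move=> Ji; split=> [s x y|x y|z|z].
- by rewrite /channel1 in_slot_lin (iso_lin Ji) advance_lin.
- have := iso_inner Ji (in_slot x) (in_slot y).
  rewrite /channel1 /advance !inner_prodE /= inner_l2_cons => Jl.
  rewrite (inner_l2_head_tail x.2.1.1 y.2.1.1).
  set a := inner (J _).1 _ in Jl *; set b := inner (J _).2 _ in Jl *.
  by rewrite !addrA (addrC (_ + _) b) !addrA (addrC b) Jl; ring.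
- rewrite /channel1 /channel1_inv.
  have -> : out_slot (advance (J (in_slot z)) z) = J (in_slot z).
    by rewrite [RHS]surjective_pairing.
  by rewrite (isoK Ji) /retreat /= l2_consK l2_cons_head; case: z => [h [[x1 x2] [y1 y2]]].
- rewrite /channel1 /channel1_inv.
  have -> : in_slot (retreat (J' (out_slot z)) z) = J' (out_slot z).
    by rewrite [RHS]surjective_pairing.
  by rewrite (isoKV Ji) /advance /= l2_consK l2_cons_head; case: z => [h [[x1 x2] [y1 y2]]].
Qed.

Lemma swap_channels_iso : hilbert_iso swap_channels swap_channels.
Proof.
split=> [s x y|x y|[h [[x1 x2] [y1 y2]]]|[h [[x1 x2] [y1 y2]]]]; [| |exact: erefl|exact: erefl].
  by rewrite /swap_channels !pair_lin !(prod_lin1, prod_lin2).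
by rewrite !inner_prodE /=; ring.
Qed.

Lemma swap_local_iso : hilbert_iso swap_local swap_local.
Proof.
split=> [s x y|x y|[h [e f]]|[h [e f]]]; [| |exact: erefl|exact: erefl].
  by rewrite /swap_local !pair_lin !(prod_lin1, prod_lin2).
by rewrite !inner_prodE /=; ring.
Qed.

Lemma local2_iso J J' : hilbert_iso J J' -> hilbert_iso (local2 J) (local2 J').
Proof.
move=> Ji; apply: (hilbert_iso_comp swap_local_iso).
exact: hilbert_iso_comp (local1_iso Ji) swap_local_iso.
Qed.

Lemma channel2_iso J J' : hilbert_iso J J' -> hilbert_iso (channel2 J) (channel2_inv J').
Proof.
move=> Ji; apply: (hilbert_iso_comp swap_channels_iso).
exact: hilbert_iso_comp (channel1_iso Ji) swap_channels_iso.
Qed.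

(** Vanishing incoming part is preserved and the [H] component evolves by [T] alone, whatever the
    outgoing part. This is stable under composition, so mixed products of powers are dilated too. *)
Definition triangular (U : K -> K) (T : H -> H) : Prop :=
  forall h y, exists y', U (h, (0, y)) = (T h, (0, y')).

Lemma triangular_comp U V S T : triangular U S -> triangular V T -> triangular (U \o V) (S \o T).
Proof.
move=> US VT h y; have [y1 h1] := VT h y; have [y2 h2] := US (T h) y1.
by exists y2; rewrite /= h1.
Qed.

Lemma triangular_opow U T n : triangular U T -> triangular (opow U n) (opow T n).
Proof.
move=> UT; elim: n => [|n IH] h y; first by exists y.
have [y1 h1] := IH h y; have [y2 h2] := UT (opow T n h) y1.
by exists y2; rewrite /opow !iterS -!/(opow _ _) h1.
Qed.

Lemma l2_tail0 : l2_tail (0 : L) = 0. Proof. exact: lin_0 (@l2_tail_lin E). Qed.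

Lemma channel1_triangular J T D : (forall h, J (h, 0) = (T h, D h)) -> triangular (channel1 J) T.
Proof.
move=> JT h y; exists (l2_cons (D h) y.1, y.2).
by rewrite /channel1 -[in_slot _]/((h, 0)) JT /advance l2_tail0.
Qed.

Lemma channel2_triangular J T D : (forall h, J (h, 0) = (T h, D h)) -> triangular (channel2 J) T.
Proof.
move=> JT h y; exists (y.1, l2_cons (D h) y.2).
rewrite /channel2 /= /channel1 -[in_slot _]/((h, 0)) JT /advance.
by rewrite /swap_channels /= l2_tail0.
Qed.

(** Comparing coordinates dictates [G]: the identity on [H], [c ^+ n] times [gm] on incoming and
    [c^* ^+ n] times [g] on outgoing coordinate n, the powers absorbing the scalar c = ql qr gained
    at each shift. A scalar on either side serves both relations of the theorem. *)
Lemma intertwiner (A B : HF -> HF) (g g' gm gm' : prodH E E -> prodH E E)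
    (Ql Qr : H -> H) (ql qr : C) :
  hilbert_iso g g' -> hilbert_iso gm gm' -> `|ql| = 1 -> `|qr| = 1 ->
  (forall h f, A (h, gm f) =
     (Ql (B (Qr h, qr *: f)).1, ql *: g (B (Qr h, qr *: f)).2)) ->
  exists G G' : K -> K, [/\ hilbert_iso G G', triangular G id, triangular G' id &
    forall z, full_shift A (G z) =
      let w := G (full_shift B (Qr z.1, qr *: z.2)) in (Ql w.1, ql *: w.2)].
Proof.
move=> gi gmi ql1 qr1 AB; pose c := ql * qr.
have c1 : `|c| = 1 by rewrite normrM ql1 qr1 mulr1.
have cn1 n : `|c ^+ n| = 1 by rewrite normrX c1 expr1n.
have cn1' n : `|c^* ^+ n| = 1 by rewrite normrX norm_conjC c1 expr1n.
have [Di [Di' [Dii DiP]]] := @diagonal_iso E _ _ (fun n =>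
  hilbert_iso_comp gmi (hilbert_iso_scale _ (cn1 n))).
have [Do [Do' [Doi DoP]]] := @diagonal_iso E _ _ (fun n =>
  hilbert_iso_comp gi (hilbert_iso_scale _ (cn1' n))).
have Giso := hilbert_iso_prod (hilbert_iso_id H) (hilbert_iso_prod Dii Doi).
exists (fun z => (z.1, (Di z.2.1, Do z.2.2))), (fun z => (z.1, (Di' z.2.1, Do' z.2.2))).
split=> [//|h y|h y|].
- by exists (Do y); rewrite /= (lin_0 (iso_lin Dii)).
- by exists (Do' y); rewrite /= (lin_0 (iso_lin (hilbert_iso_sym Dii))).
move=> [h [x y]]; rewrite /full_shift /= DiP /= expr0 scale1r AB /=.
have -> : pair_coord (qr *: x) 0 = qr *: pair_coord x 0 by [].
set p := B _.
congr (_, (_, _)).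
  (* Incoming part: coordinate n after the shift was coordinate n + 1 before it, whence one more
     factor [c] on the left. *)
  apply: pair_coord_ext => n; rewrite -[LHS]/(pair_coord (Di x) n.+1).
  rewrite -[RHS]/(ql *: pair_coord (Di (l2_tail (qr *: x.1), l2_tail (qr *: x.2))) n) !DiP /=.
  rewrite -[pair_coord (_, _) n]/(qr *: pair_coord x n.+1) (lin_Z (iso_lin gmi)).
  by rewrite !scalerA; congr (_ *: _); rewrite /c exprS; ring.
apply: pair_coord_ext => n.
rewrite -[RHS]/(ql *: pair_coord (Do (l2_cons p.2.1 (qr *: y.1), l2_cons p.2.2 (qr *: y.2))) n).
rewrite DoP /=.
(* Outgoing part: coordinate 0 has just been emitted by the local operator, as described by [AB];
   coordinate n + 1 was coordinate n, and the extra [c^*] cancels ql qr. *)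
case: n => [|n].
  rewrite expr0 scale1r -[LHS]/(ql *: g p.2) -[pair_coord _ 0]/((p.2.1, p.2.2)).
  by rewrite -surjective_pairing.
rewrite -[LHS]/(pair_coord (Do y) n) DoP /= -[pair_coord (_, _) n.+1]/(qr *: pair_coord y n).
rewrite (lin_Z (iso_lin gi)) !scalerA; congr (_ *: _); rewrite exprS.
have -> : ql * (c^* * c^* ^+ n) * qr = (c * c^*) * c^* ^+ n by rewrite /c; ring.
by rewrite mul_conj_unit // mul1r.
Qed.

End Scattering.

(** * The embedded copy of H and the operator Q + q *)

Section FirstSummand.
Variables (H L : hilbertSpace).
Local Notation K := (prodH H L).

Definition embed (h : H) : K := (h, 0).
Definition project (z : K) : K := (z.1, 0).
Definition extend_scalar (Q : H -> H) (q : C) (z : K) : K := (Q z.1, q *: z.2).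

Lemma embed_isometric : isometric_embedding embed.
Proof.
split=> [s x y|x y]; first by rewrite /embed pair_lin scaler0 addr0.
by rewrite inner_prodE /= inner0l addr0.
Qed.

Lemma inner_embed z h : inner z (embed h) = inner z.1 h.
Proof. by rewrite inner_prodE /= inner0r addr0. Qed.

Lemma orth_embed z : orth_to_range embed z -> z.1 = 0.
Proof. by move=> zo; apply: hs_inner_eq0; rewrite -[LHS]/(inner _ _) -inner_embed. Qed.

Lemma project_orth : orth_proj_onto embed project.
Proof.
move=> z; split; first by exists z.1.
by move=> h; rewrite innerDl innerNl !inner_embed subrr.
Qed.

Lemma extend_scalar_iso Q Q' q : hilbert_iso Q Q' -> `|q| = 1 ->
  hilbert_iso (extend_scalar Q q) (extend_scalar Q' q^*).
Proof. by move=> Qi q1; exact: hilbert_iso_prod Qi (hilbert_iso_scale L q1). Qed.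

Lemma extend_scalar_embed (Q : H -> H) q h : extend_scalar Q q (embed h) = embed (Q h).
Proof. by rewrite /extend_scalar /= scaler0. Qed.

Lemma extend_scalar_orth Q q z : is_linear Q -> orth_to_range embed z ->
  extend_scalar Q q z = q *: z.
Proof.
move=> Qlin /orth_embed z0; rewrite /extend_scalar z0 (lin_0 Qlin).
by apply: prod_ext => //=; rewrite z0 scaler0.
Qed.

Lemma extend_scalar_reduces Q q : is_linear Q -> reduces embed (extend_scalar Q q).
Proof.
move=> Qlin; split=> [h|z zo h].
  by exists (Q h); rewrite extend_scalar_embed.
by rewrite (extend_scalar_orth q Qlin zo) innerZl zo mulr0.
Qed.

End FirstSummand.

(** * Assembling the dilation *)

Lemma power_dilation (H E : hilbertSpace) U1 U2 (T1 T2 : H -> H) n m h :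
  triangular (E := E) U1 T1 -> triangular U2 T2 ->
  embed _ (opow T1 n (opow T2 m h)) = project (opow U1 n (opow U2 m (embed _ h))).
Proof.
move=> t1 t2.
(* The product of powers is triangular over the product of the powers of [T1] and [T2]; starting
   from [(h, 0)], only an outgoing part [y] appears, and [project] removes it. *)
have [y yP] := triangular_comp (triangular_opow n t1) (triangular_opow m t2) h 0.
by rewrite -[embed _ h]/((h, (0, 0))) [opow U1 _ _]yP.
Qed.

(** Ando's argument: the Gram forms of [a] and [b] are those of 1 minus the ones of T1 T2 Qr and of
    T2 T1, equal because [Ql] and [Qr] are unitary. [b] is first placed in the padding slots to be
    orthogonal to [a]; [p] moves it back and a factor [ql^*] cancels [ql]. *)
Lemma outgoing_intertwiner (H : hilbertSpace) (T1 T2 D1 D2 Ql Qr Ql' Qr' : H -> H) (ql : C) :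
  is_linear T1 -> is_linear T2 -> is_linear D1 -> is_linear D2 ->
  (forall x y, inner (D1 x) (D1 y) = inner x y - inner (T1 x) (T1 y)) ->
  (forall x y, inner (D2 x) (D2 y) = inner x y - inner (T2 x) (T2 y)) ->
  hilbert_iso Ql Ql' -> hilbert_iso Qr Qr' -> `|ql| = 1 ->
  (forall x, T2 (T1 x) = Ql (T1 (T2 (Qr x)))) ->
  exists g g' : prodH (prodH H H) (prodH H H) -> prodH (prodH H H) (prodH H H),
    hilbert_iso g g' /\ forall h,
      ql *: g ((D1 (T2 (Qr h)), 0), (D2 (Qr h), 0)) = ((D1 h, 0), (D2 (T1 h), 0)).
Proof.
move=> T1l T2l D1l D2l D1T D2T Qli Qri ql1 TQ.
pose F := prodH (prodH H H) (prodH H H).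
pose a h : F := ((D1 (T2 (Qr h)), 0), (D2 (Qr h), 0)).
pose b h : F := ((0, D1 h), (0, D2 (T1 h))).
have Qrl := iso_lin Qri.
have [||h k|h k|G [Gi Gab]] := @exchange_reflection H F a b.
- by move=> s x y; rewrite /a !pair_lin Qrl T2l D1l D2l scaler0 addr0.
- by move=> s x y; rewrite /b !pair_lin T1l D1l D2l scaler0 addr0.
- rewrite !inner_prodE /= !inner0l !D1T !D2T !TQ (iso_inner Qli) (iso_inner Qri); ring.
- by rewrite !inner_prodE /= !inner0l !inner0r !addr0.
pose p (z : F) : F := ((z.1.2, z.1.1), (z.2.2, z.2.1)).
have pi : hilbert_iso p p.
  split=> [s x y|x y|[[x1 x2] [y1 y2]]|[[x1 x2] [y1 y2]]]; [| |exact: erefl|exact: erefl].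
    by rewrite /p !pair_lin !(prod_lin1, prod_lin2).
  by rewrite !inner_prodE /=; ring.
have ql1' : `|ql^*| = 1 by rewrite norm_conjC.
have gi := hilbert_iso_comp (hilbert_iso_comp Gi pi) (hilbert_iso_scale F ql1').
eexists _, _; split; first exact: gi.
move=> h; rewrite /= scalerA (mul_conj_unit ql1) scale1r.
by rewrite -[((D1 (T2 _), 0), _)]/(a h) Gab.
Qed.

(* The incoming intertwiner is forced by the outgoing one: [A^-1 (Ql + ql g) B (Qr + qr)]
   is unitary and fixes [H] pointwise, hence splits. *)
Lemma incoming_intertwiner (H F : hilbertSpace) (A A' B B' : prodH H F -> prodH H F)
    (Ql Ql' Qr Qr' : H -> H) (g g' : F -> F) (ql qr : C) :
  hilbert_iso A A' -> hilbert_iso B B' -> hilbert_iso Ql Ql' -> hilbert_iso Qr Qr' ->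
  hilbert_iso g g' -> `|ql| = 1 -> `|qr| = 1 ->
  (forall h, A (h, 0) = (Ql (B (Qr h, 0)).1, ql *: g (B (Qr h, 0)).2)) ->
  exists gm gm' : F -> F, hilbert_iso gm gm' /\ forall h f,
    A (h, gm f) = (Ql (B (Qr h, qr *: f)).1, ql *: g (B (Qr h, qr *: f)).2).
Proof.
move=> Ai Bi Qli Qri gi ql1 qr1 AB.
have Zi := hilbert_iso_comp (hilbert_iso_prod Qri (hilbert_iso_scale F qr1))
  (hilbert_iso_comp Bi
    (hilbert_iso_comp (hilbert_iso_prod Qli (hilbert_iso_comp gi (hilbert_iso_scale F ql1)))
      (hilbert_iso_sym Ai))).
have [|gm [gm' [gmi gmP]]] := iso_fixing_summand Zi.
  by move=> h; rewrite -[RHS](isoK Ai) AB /= scaler0.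
exists gm, gm'; split=> // h f.
by rewrite -gmP /= (isoKV Ai).
Qed.

(** The two relations of the theorem are the cases (Ql, Qr) = (Q, id) and (id, Q), with scalars (q,
    1) and (1, q). *)
Lemma scattering_pair (H : hilbertSpace) (T1 T2 Ql Qr Ql' Qr' : H -> H) (ql qr : C) :
  contraction T1 -> contraction T2 -> hilbert_iso Ql Ql' -> hilbert_iso Qr Qr' ->
  `|ql| = 1 -> `|qr| = 1 -> (forall x, T2 (T1 x) = Ql (T1 (T2 (Qr x)))) ->
  let L := l2H (prodH H H) in let K := prodH H (prodH (prodH L L) (prodH L L)) in
  exists W1 W1' W2 W2' G G' : K -> K,
    [/\ [/\ hilbert_iso W1 W1', hilbert_iso W2 W2' & hilbert_iso G G'],
        [/\ triangular W1 T1, triangular W2 T2, triangular G id & triangular G' id] &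
        forall z, W2 (W1 (G z)) =
          extend_scalar Ql ql (G (W1 (W2 (extend_scalar Qr qr z))))].
Proof.
move=> T1c T2c Qli Qri ql1 qr1 TQ L K.
have [D1 [J1 [J1' [D1l D1T J1i J1T]]]] := julia_iso T1c.
have [D2 [J2 [J2' [D2l D2T J2i J2T]]]] := julia_iso T2c.
have T1l : is_linear T1 by case: T1c => [[]].
have T2l : is_linear T2 by case: T2c => [[]].
have [g [g' [gi gab]]] := outgoing_intertwiner T1l T2l D1l D2l D1T D2T Qli Qri ql1 TQ.
pose A := local2 J2 \o local1 J1; pose B := local1 J1 \o local2 J2.
have Ai : hilbert_iso A _ := hilbert_iso_comp (local1_iso J1i) (local2_iso J2i).
have Bi : hilbert_iso B _ := hilbert_iso_comp (local2_iso J2i) (local1_iso J1i).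
have AE h : A (h, 0) = (T2 (T1 h), ((D1 h, 0), (D2 (T1 h), 0))).
  by rewrite -[(h, 0)]/((h, (0, 0))) /A /= (local1E _ (J1T h)) (local2E _ (J2T _)).
have BE h : B (h, 0) = (T1 (T2 h), ((D1 (T2 h), 0), (D2 h, 0))).
  by rewrite -[(h, 0)]/((h, (0, 0))) /B /= (local2E _ (J2T h)) (local1E _ (J1T _)).
have [|gm [gm' [gmi AB]]] := incoming_intertwiner Ai Bi Qli Qri gi ql1 qr1.
  by move=> h; rewrite AE BE /= gab -TQ.
have [G [G' [Gi Gt Gt' GP]]] := intertwiner gi gmi ql1 qr1 AB.
exists (channel1 J1), (channel1_inv J1'), (channel2 J2), (channel2_inv J2'), G, G'.
split.
- by split; [exact: channel1_iso|exact: channel2_iso|exact: Gi].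
- split; [exact: channel1_triangular J1T|exact: channel2_triangular J2T|exact: Gt|exact: Gt'].
- by move=> z; rewrite channel21 channel12; exact: GP.
Qed.

Theorem mainTheorem1 (H : hilbertSpace) (T1 T2 Q : H -> H) :
  contraction T1 -> contraction T2 -> unitary Q ->
  forall q : C, `|q| = 1 ->
  (* case T2 T1 = Q T1 T2 *)
  ((forall x : H, T2 (T1 x) = Q (T1 (T2 x))) ->
    exists (K : hilbertSpace) (J : H -> K) (P Qb U1 U2 : K -> K),
      isometric_embedding J /\ orth_proj_onto J P /\
      unitary Qb /\ unitary U1 /\ unitary U2 /\
      reduces J Qb /\ (forall h : H, Qb (J h) = J (Q h)) /\
      (forall k : K, orth_to_range J k -> Qb k = q *: k) /\
      (forall k : K, U2 (U1 k) = Qb (U1 (U2 k))) /\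
      (forall (n m : nat) (h : H),
          J (opow T1 n (opow T2 m h)) = P (opow U1 n (opow U2 m (J h))) /\
          J (opow T2 n (opow T1 m h)) = P (opow U2 n (opow U1 m (J h))))) /\
  (* case T2 T1 = T1 T2 Q *)
  ((forall x : H, T2 (T1 x) = T1 (T2 (Q x))) ->
    exists (K : hilbertSpace) (J : H -> K) (P Qb U1 U2 : K -> K),
      isometric_embedding J /\ orth_proj_onto J P /\
      unitary Qb /\ unitary U1 /\ unitary U2 /\
      reduces J Qb /\ (forall h : H, Qb (J h) = J (Q h)) /\
      (forall k : K, orth_to_range J k -> Qb k = q *: k) /\
      (forall k : K, U2 (U1 k) = U1 (U2 (Qb k))) /\
      (forall (n m : nat) (h : H),
          J (opow T1 n (opow T2 m h)) = P (opow U1 n (opow U2 m (J h))) /\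
          J (opow T2 n (opow T1 m h)) = P (opow U2 n (opow U1 m (J h))))).
Proof.
move=> T1c T2c /unitary_hilbert_iso[Q' Qi] q q1.
have Ii := hilbert_iso_id H; have n1 : `|1 : C| = 1 by rewrite normr1.
have ext1 L (z : prodH H L) : extend_scalar id 1 z = z.
  by case: z => h y; rewrite /extend_scalar /= scale1r.
(* The clauses shared by both cases; [P1] and [P2] stand for the commutation relation and the power
   dilation. *)
have common L (U1 U2 U1' U2' : prodH H L -> prodH H L) (P1 P2 : Prop) :
    hilbert_iso U1 U1' -> hilbert_iso U2 U2' -> P1 -> P2 ->
    isometric_embedding (@embed H L) /\ orth_proj_onto (@embed H L) (@project H L) /\
    unitary (extend_scalar (L := L) Q q) /\ unitary U1 /\ unitary U2 /\
    reduces (@embed H L) (extend_scalar Q q) /\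
    (forall h : H, extend_scalar Q q (@embed H L h) = embed L (Q h)) /\
    (forall k : prodH H L, orth_to_range (@embed H L) k -> extend_scalar Q q k = q *: k) /\
    P1 /\ P2.
  move=> U1i U2i p1 p2; have Ql := iso_lin Qi.
  split; first exact: embed_isometric.
  split; first exact: project_orth.
  split; first exact: hilbert_iso_unitary (extend_scalar_iso L Qi q1).
  split; first exact: hilbert_iso_unitary U1i.
  split; first exact: hilbert_iso_unitary U2i.
  split; first exact: extend_scalar_reduces.
  split=> [h|]; first exact: extend_scalar_embed.
  by split=> // k; exact: extend_scalar_orth.
split=> TQ.
- have [W1 [W1' [W2 [W2' [G [G' [[W1i W2i Gi] [W1t W2t Gt Gt'] rel]]]]]]] :=
    scattering_pair T1c T2c Qi Ii q1 n1 TQ.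
  (* Here [U2 U1 = W2 W1], and the relation at [G' k] equates it with [Qb G W1 W2 G' = Qb U1 U2].
     Composing with [G] or [G'] keeps the compressions, both being triangular over the identity. *)
  exists _, (embed _), (@project _ _), (extend_scalar Q q), (G \o W1), (W2 \o G').
  have U1t : triangular (G \o W1) T1 := triangular_comp Gt W1t.
  have U2t : triangular (W2 \o G') T2 := triangular_comp W2t Gt'.
  apply: common.
  + exact: hilbert_iso_comp W1i Gi.
  + exact: hilbert_iso_comp (hilbert_iso_sym Gi) W2i.
  + by move=> k; have := rel (G' k); rewrite ext1 (isoKV Gi) /= (isoK Gi).
  + by move=> n m h; split; apply: power_dilation.
have [W1 [W1' [W2 [W2' [G [G' [[W1i W2i Gi] [W1t W2t Gt Gt'] rel]]]]]]] :=
  scattering_pair T1c T2c Ii Qi n1 q1 TQ.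
(* Now [Qb] acts first, so [G] sits on the other side: [U1 U2 = W1 W2], and [U2 U1 = G' W2 W1 G] is
   [W1 W2 Qb]. *)
exists _, (embed _), (@project _ _), (extend_scalar Q q), (W1 \o G), (G' \o W2).
have U1t : triangular (W1 \o G) T1 := triangular_comp W1t Gt.
have U2t : triangular (G' \o W2) T2 := triangular_comp Gt' W2t.
apply: common.
- exact: hilbert_iso_comp Gi W1i.
- exact: hilbert_iso_comp W2i (hilbert_iso_sym Gi).
- by move=> k; rewrite /= rel ext1 (isoK Gi) (isoKV Gi).
- by move=> n m h; split; apply: power_dilation.
Qed.
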